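(* Let $I\subsetneq\mathbb F\langle x,x^*\rangle$ be a proper $*$-ideal generated (as a $*$-ideal) by homogeneous analytic polynomials. Then there exist a Hilbert space $\mathcal H$ and a tuple $X=(X_1,\dots,X_g)$ of bounded operators on $\mathcal H$ such that for every $p\in\mathbb F\langle x,x^*\rangle$, $p(X)=0$ if and only if $p\in I$. In particular $\sqrt[\mathrm{hard}]{I}=I$.
   Context: $\mathbb F\in\{\mathbb R,\mathbb C\}$. $\mathbb F\langle x,x^*\rangle$ is the free $*$-algebra: polynomials in the $2g$ freely noncommuting letters $x_1,\dots,x_g,x_1^*,\dots,x_g^*$ over $\mathbb F$, with involution conjugating coefficients, reversing words and interchanging $x_j\leftrightarrow x_j^*$. A polynomial is analytic if it contains no letter $x_j^*$; it is homogeneous if it is a linear combination of words of the same length. A $*$-ideal is a two-sided ideal $I$ with $I^*=I$. For a tuple $X$ of operators (or matrices), $p(X)$ is obtained by substituting $X_j$ for $x_j$ and the adjoint $X_j^*$ for $x_j^*$. $\sqrt[\mathrm{hard}]{I}$ is the set of $p$ with $p(X)=0$ for every $n\ge1$ and every $X\in M_n(\mathbb F)^g$ satisfying $q(X)=0$ for all $q\in I$. *)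

(* Defs.v *)
From Stdlib Require Import Reals.
From Stdlib Require List.
From mathcomp Require Import all_boot.

Set Implicit Arguments.
Unset Strict Implicit.
Unset Printing Implicit Defensive.

Record cplx := Cmk { Cre : R; Cim : R }.
Definition Cadd (a b : cplx) : cplx := Cmk (Rplus (Cre a) (Cre b)) (Rplus (Cim a) (Cim b)).
Definition Cmul (a b : cplx) : cplx :=
  Cmk (Rminus (Rmult (Cre a) (Cre b)) (Rmult (Cim a) (Cim b)))
      (Rplus (Rmult (Cre a) (Cim b)) (Rmult (Cim a) (Cre b))).
Definition Cconj (a : cplx) : cplx := Cmk (Cre a) (Ropp (Cim a)).

Inductive fkind := RealF | ComplexF.

Definition scal (k : fkind) : Type :=
  match k with RealF => R | ComplexF => cplx end.

Definition F0 (k : fkind) : scal k :=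
  match k return scal k with RealF => R0 | ComplexF => Cmk R0 R0 end.
Definition F1 (k : fkind) : scal k :=
  match k return scal k with RealF => R1 | ComplexF => Cmk R1 R0 end.
Definition Fadd (k : fkind) : scal k -> scal k -> scal k :=
  match k return scal k -> scal k -> scal k with RealF => Rplus | ComplexF => Cadd end.
Definition Fmul (k : fkind) : scal k -> scal k -> scal k :=
  match k return scal k -> scal k -> scal k with RealF => Rmult | ComplexF => Cmul end.
Definition Fconj (k : fkind) : scal k -> scal k :=
  match k return scal k -> scal k with RealF => fun x => x | ComplexF => Cconj end.
Definition Fre (k : fkind) : scal k -> R :=
  match k return scal k -> R with RealF => fun x => x | ComplexF => Cre end.

(* a letter is (j, starred?) : (j, false) = x_j, (j, true) = x_j^* *)
Definition letter (g : nat) := ('I_g * bool)%type.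
Definition word (g : nat) := seq (letter g).
(* a polynomial is represented by a finite formal sum of monomials c*w;
   two representations denote the same polynomial iff they have the same
   coefficient function [coef]. All notions below depend only on [coef]. *)
Definition ncpoly (k : fkind) (g : nat) := seq (scal k * word g).

Definition coef (k : fkind) (g : nat) (p : ncpoly k g) (w : word g) : scal k :=
  foldr (fun t acc => if t.2 == w then Fadd t.1 acc else acc) (F0 k) p.

Definition pmul (k : fkind) (g : nat) (p q : ncpoly k g) : ncpoly k g :=
  [seq (Fmul a.1 b.1, a.2 ++ b.2) | a <- p, b <- q].

Definition lstar (g : nat) (l : letter g) : letter g := (l.1, ~~ l.2).
Definition wstar (g : nat) (w : word g) : word g := rev (map (@lstar g) w).
Definition pstar (k : fkind) (g : nat) (p : ncpoly k g) : ncpoly k g :=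
  map (fun t => (Fconj t.1, wstar t.2)) p.

Definition homogeneous (k : fkind) (g : nat) (p : ncpoly k g) : Prop :=
  exists d : nat, forall w, coef p w <> F0 k -> size w = d.
Definition analytic (k : fkind) (g : nat) (p : ncpoly k g) : Prop :=
  forall w, coef p w <> F0 k -> all (fun l : letter g => ~~ l.2) w.

(* membership in the *-ideal generated by S: the two-sided ideal generated by
   S together with S^* , i.e. finite sums of a * s * b or a * s^* * b, s in S *)
Definition gen_term (k : fkind) (g : nat) (t : ncpoly k g * ncpoly k g * ncpoly k g * bool)
  : ncpoly k g :=
  pmul (pmul t.1.1.1 (if t.2 then pstar t.1.1.2 else t.1.1.2)) t.1.2.

Definition in_star_ideal (k : fkind) (g : nat) (S : ncpoly k g -> Prop) (p : ncpoly k g)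
  : Prop :=
  exists l : seq (ncpoly k g * ncpoly k g * ncpoly k g * bool),
    List.Forall (fun t => S t.1.1.2) l /\
    forall w, coef p w = coef (flatten (map (@gen_term k g) l)) w.

Definition eval_word (k : fkind) (g : nat) (A : Type) (one : A) (mul : A -> A -> A)
  (X Xs : 'I_g -> A) (w : word g) : A :=
  foldr (fun l acc => mul (if l.2 then Xs l.1 else X l.1) acc) one w.

Definition eval_poly (k : fkind) (g : nat) (A : Type) (zero one : A)
  (add mul : A -> A -> A) (sc : scal k -> A -> A) (X Xs : 'I_g -> A) (p : ncpoly k g) : A :=
  foldr (fun t acc => add (sc t.1 (eval_word k one mul X Xs t.2)) acc) zero p.

Record hilbert (k : fkind) := Hilbert {
  hcar :> Type;
  hzero : hcar;
  hadd : hcar -> hcar -> hcar;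
  hopp : hcar -> hcar;
  hscale : scal k -> hcar -> hcar;
  hinner : hcar -> hcar -> scal k;
  haddA : forall u v w, hadd u (hadd v w) = hadd (hadd u v) w;
  haddC : forall u v, hadd u v = hadd v u;
  hadd0 : forall u, hadd u hzero = u;
  haddN : forall u, hadd u (hopp u) = hzero;
  hscaleA : forall a b u, hscale a (hscale b u) = hscale (Fmul a b) u;
  hscale1 : forall u, hscale (F1 k) u = u;
  hscaleDr : forall a u v, hscale a (hadd u v) = hadd (hscale a u) (hscale a v);
  hscaleDl : forall a b u, hscale (Fadd a b) u = hadd (hscale a u) (hscale b u);
  hinnerDl : forall u v w, hinner (hadd u v) w = Fadd (hinner u w) (hinner v w);
  hinnerZl : forall a u w, hinner (hscale a u) w = Fmul a (hinner u w);
  hinnerC : forall u v, hinner v u = Fconj (hinner u v);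
  hinner_ge0 : forall u, Rle R0 (Fre (hinner u u));
  hinner_eq0 : forall u, Fre (hinner u u) = R0 -> u = hzero;
  hcomplete : forall s : nat -> hcar,
    (forall eps, Rlt R0 eps -> exists N : nat, forall m n, (N <= m)%N -> (N <= n)%N ->
       Rlt (sqrt (Fre (hinner (hadd (s m) (hopp (s n))) (hadd (s m) (hopp (s n)))))) eps) ->
    exists v, forall eps, Rlt R0 eps -> exists N : nat, forall n, (N <= n)%N ->
       Rlt (sqrt (Fre (hinner (hadd (s n) (hopp v)) (hadd (s n) (hopp v))))) eps
}.

Definition hnorm (k : fkind) (H : hilbert k) (u : H) : R := sqrt (Fre (hinner u u)).

Definition bounded_op (k : fkind) (H : hilbert k) (T : H -> H) : Prop :=
  (forall u v, T (hadd u v) = hadd (T u) (T v)) /\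
  (forall a u, T (hscale a u) = hscale a (T u)) /\
  exists M : R, forall u, Rle (hnorm (T u)) (Rmult M (hnorm u)).

Definition is_adjoint (k : fkind) (H : hilbert k) (T Ts : H -> H) : Prop :=
  forall u v, hinner (T u) v = hinner u (Ts v).

(* p(X) as an operator on H, where Xs j is the adjoint X_j^* *)
Definition op_eval (k : fkind) (g : nat) (H : hilbert k) (X Xs : 'I_g -> H -> H)
  (p : ncpoly k g) : H -> H :=
  eval_poly (fun _ : H => hzero H) (fun v : H => v)
    (fun S T v => hadd (S v) (T v)) (fun S T v => S (T v))
    (fun a T v => hscale a (T v)) X Xs p.

(* a matrix is given by its entries; only indices i, j < n are relevant *)
Definition mat (k : fkind) := nat -> nat -> scal k.

Definition mat_eval (k : fkind) (g : nat) (n : nat) (X : 'I_g -> mat k) (p : ncpoly k g)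
  : mat k :=
  eval_poly (fun _ _ => F0 k) (fun i j => if i == j then F1 k else F0 k)
    (fun A B i j => Fadd (A i j) (B i j))
    (fun A B i j => foldr (fun l acc => Fadd (Fmul (A i l) (B l j)) acc) (F0 k) (iota 0 n))
    (fun a A i j => Fmul a (A i j))
    X (fun m i j => Fconj (X m j i)) p.

Definition mat_is_zero (k : fkind) (n : nat) (M : mat k) : Prop :=
  forall i j, (i < n)%N -> (j < n)%N -> M i j = F0 k.

Definition hard_radical (k : fkind) (g : nat) (S : ncpoly k g -> Prop) (p : ncpoly k g)
  : Prop :=
  forall n : nat, (0 < n)%N -> forall X : 'I_g -> mat k,
    (forall q, in_star_ideal S q -> mat_is_zero n (mat_eval n X q)) ->
    mat_is_zero n (mat_eval n X p).

(* Main.v *)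
From Coquelicot Require Import Coquelicot.
From Stdlib Require Import Reals Lra.
From HB Require Import structures.
Require Import Defs.
From mathcomp Require Import all_boot all_algebra.
From mathcomp Require Import boolp.

                                                                                        
                                                                                          
                                                                                        
                                                                                  
                                                                                    
                                                                                  
                                                                                          
                                                                                        
                                                                                           
                                                                                           
                                                                        

Set Implicit Arguments.
Unset Strict Implicit.
Unset Printing Implicit Defensive.

Import GRing.Theory.

                                                                        
Delimit Scope R_scope with Re.
Local Open Scope ring_scope.

(** Write [I] for the ideal. Its generators and their stars are homogeneous, so [I] is graded.
    Hence, for each N, right multiplication on the free algebra modulo [I] and modulo words longer
    than N gives matrices A_j, C_j (for x_j and its star) with two properties: every q in [I]
    satisfies q(A,C) = 0, and p(A,C) = 0 forces p into [I] when p has degree at most N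
    ([finite_quotient]). The defect is that C_j need not be the adjoint of A_j.

    The repair is a doubling trick. Let B_j be the adjoint of C_j, write A = P + Q and B = P - Q,
    and let X_t be the 2x2 block tuple with rows (P, tQ) and (Q/t, P). For t nonzero X_t is similar
    to the direct sum of A and B. So an analytic generator q vanishes at X_t: q(A) = 0, and q(B) is
    the adjoint of the value of the star of q at (A,C), again 0 ([mxeval_Xd_analytic]). Thus X_t
    with its true adjoint annihilates [I]. Conversely, for real t, conjugation by diag(t,1) turns
    X_t and its adjoint into X_1 and a tuple Y_s that is Laurent in s = t^2 ([mxeval_Xd_conj]). If p
    vanishes at X_t for infinitely many values of t^2, then p(X_1,Y_s) = 0 for all nonzero s. At s =
    -1 the vectors (v,v) form an invariant subspace on which X_1 and Y_s act as A and C
    ([mxeval_Xd_Yd]), so p(A,C) = 0. This gives [separating_family].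

    Taking t in (1,2] bounds the matrices uniformly, and gradedness allows them to be rescaled to
    contractions. The block-diagonal operator over all pairs (N,t) acts on an l2 direct sum, and p
    vanishes there iff it vanishes on every block, iff p lies in [I] ([countable_family]). The
    blocks are matrix points of [I], so they also settle the hard radical. *)

(** * The scalars as a field with conjugation *)

Section ScalarField.
Variable k : fkind.
Implicit Types a b c : scal k.

Definition Fim : scal k -> R :=
  match k return scal k -> R with RealF => fun _ => R0 | ComplexF => Cim end.

                                                          
(** The imaginary argument is dropped over the reals, so one formula in real and imaginary parts
    serves both fields. *)
Definition Fmk : R -> R -> scal k :=
  match k return R -> R -> scal k with RealF => fun x _ => x | ComplexF => Cmk end.

Definition Fopp a : scal k := Fmk (- Fre a)%Re (- Fim a)%Re.

Definition Fnsq a : R := (Fre a * Fre a + Fim a * Fim a)%Re.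

Definition Finv a : scal k := Fmk (Fre a / Fnsq a)%Re (- Fim a / Fnsq a)%Re.

Lemma scal_ext a b : Fre a = Fre b -> Fim a = Fim b -> a = b.
Proof. by rewrite /Fim; case: k a b => //= -[x y] [x' y'] /= -> ->. Qed.

Lemma Fre_mk x y : Fre (Fmk x y) = x.
Proof. by rewrite /Fmk /Fre; case: k. Qed.

Lemma Fim_mk x y : (k = RealF -> y = R0) -> Fim (Fmk x y) = y.
Proof. by rewrite /Fmk /Fim; case: k => // ->. Qed.

Lemma Fim_real a : k = RealF -> Fim a = R0.
Proof. by rewrite /Fim; case: k a. Qed.

Lemma Fre_add a b : Fre (Fadd a b) = (Fre a + Fre b)%Re.
Proof. by rewrite /Fadd /Fre; case: k a b. Qed.

Lemma Fim_add a b : Fim (Fadd a b) = (Fim a + Fim b)%Re.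
Proof. rewrite /Fadd /Fim; case: k a b => //= *; lra. Qed.

Lemma Fre_mul a b : Fre (Fmul a b) = (Fre a * Fre b - Fim a * Fim b)%Re.
Proof. rewrite /Fmul /Fre /Fim; case: k a b => //= *; lra. Qed.

Lemma Fim_mul a b : Fim (Fmul a b) = (Fre a * Fim b + Fim a * Fre b)%Re.
Proof. rewrite /Fmul /Fre /Fim; case: k a b => //= *; lra. Qed.

Lemma Fre_opp a : Fre (Fopp a) = (- Fre a)%Re.
Proof. by rewrite Fre_mk. Qed.

Lemma Fim_opp a : Fim (Fopp a) = (- Fim a)%Re.
Proof. by rewrite Fim_mk // => /Fim_real ->; lra. Qed.

Lemma Fre0 : Fre (F0 k) = R0. Proof. by case: k. Qed.
Lemma Fim0 : Fim (F0 k) = R0. Proof. by rewrite /Fim; case: k. Qed.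
Lemma Fre1 : Fre (F1 k) = R1. Proof. by case: k. Qed.
Lemma Fim1 : Fim (F1 k) = R0. Proof. by rewrite /Fim; case: k. Qed.

Lemma Fre_conj a : Fre (Fconj a) = Fre a.
Proof. by rewrite /Fre /Fconj; case: k a. Qed.

Lemma Fim_conj a : Fim (Fconj a) = (- Fim a)%Re.
Proof. rewrite /Fim /Fconj; case: k a => //= *; lra. Qed.

Lemma Fnsq_ge0 a : (0 <= Fnsq a)%Re.
Proof. rewrite /Fnsq; nra. Qed.

Lemma Fnsq_eq0 a : Fnsq a = R0 -> a = F0 k.
Proof. by rewrite /Fnsq => H; apply: scal_ext; rewrite ?Fre0 ?Fim0; nra. Qed.

Definition FE := (Fre_add, Fim_add, Fre_mul, Fim_mul, Fre_opp, Fim_opp,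
                  Fre0, Fim0, Fre1, Fim1, Fre_conj, Fim_conj).

Ltac solveF := move=> *; apply: scal_ext; rewrite !FE; lra.

Fact FaddA : associative (@Fadd k). Proof. solveF. Qed.
Fact FaddC : commutative (@Fadd k). Proof. solveF. Qed.
Fact Fadd0 : left_id (F0 k) (@Fadd k). Proof. solveF. Qed.
Fact FaddN : left_inverse (F0 k) Fopp (@Fadd k). Proof. solveF. Qed.
Fact FmulA : associative (@Fmul k). Proof. solveF. Qed.
Fact FmulC : commutative (@Fmul k). Proof. solveF. Qed.
Fact Fmul1 : left_id (F1 k) (@Fmul k). Proof. solveF. Qed.
Fact FmulDl : left_distributive (@Fmul k) (@Fadd k). Proof. solveF. Qed.

HB.instance Definition _ := gen_eqMixin (scal k).
HB.instance Definition _ := gen_choiceMixin (scal k).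
HB.instance Definition _ := GRing.isZmodule.Build (scal k) FaddA FaddC Fadd0 FaddN.

Fact F1_neq0 : F1 k != F0 k.
Proof. by apply/eqP => /(congr1 (@Fre k)); rewrite Fre1 Fre0; lra. Qed.

HB.instance Definition _ :=
  GRing.Zmodule_isComNzRing.Build (scal k) FmulA FmulC Fmul1 FmulDl F1_neq0.

Fact FmulV a : a != 0 -> Fmul (Finv a) a = F1 k.
Proof.
move=> /eqP a0; have n0 : Fnsq a <> R0 by move=> /Fnsq_eq0.
have im : Fim (Finv a) = (- Fim a / Fnsq a)%Re.
  by rewrite Fim_mk // => /Fim_real ->; lra.
apply: scal_ext; rewrite !FE im Fre_mk; last by field.
have -> : (Fre a / Fnsq a * Fre a - - Fim a / Fnsq a * Fim a = Fnsq a / Fnsq a)%Re.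
  by rewrite {3}/Fnsq; field.
exact: Rdiv_diag.
Qed.

Fact Finv0 : Finv (F0 k) = F0 k.
Proof.
have im : Fim (Finv (F0 k)) = (- Fim (F0 k) / Fnsq (F0 k))%Re.
  by rewrite Fim_mk // => /Fim_real ->; lra.
by apply: scal_ext; rewrite ?im ?Fre_mk !FE; lra.
Qed.

HB.instance Definition _ := GRing.ComNzRing_isField.Build (scal k) FmulV Finv0.

Fact Fconj_is_zmod_morphism : zmod_morphism (@Fconj k).
Proof. by move=> a b; apply: scal_ext; rewrite !FE; lra. Qed.

Fact Fconj_is_monoid_morphism : monoid_morphism (@Fconj k).
Proof. by split=> [|a b]; apply: scal_ext; rewrite !FE; lra. Qed.

HB.instance Definition _ :=
  GRing.isZmodMorphism.Build (scal k) (scal k) (@Fconj k) Fconj_is_zmod_morphism.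
HB.instance Definition _ :=
  GRing.isMonoidMorphism.Build (scal k) (scal k) (@Fconj k) Fconj_is_monoid_morphism.

Lemma FconjK : involutive (@Fconj k).
Proof. by move=> a; apply: scal_ext; rewrite !FE; lra. Qed.

Lemma FreD a b : Fre (a + b) = (Fre a + Fre b)%Re. Proof. exact: Fre_add. Qed.
Lemma FimD a b : Fim (a + b) = (Fim a + Fim b)%Re. Proof. exact: Fim_add. Qed.
Lemma FreM a b : Fre (a * b) = (Fre a * Fre b - Fim a * Fim b)%Re.
Proof. exact: Fre_mul. Qed.
Lemma FimM a b : Fim (a * b) = (Fre a * Fim b + Fim a * Fre b)%Re.
Proof. exact: Fim_mul. Qed.
Lemma FreN a : Fre (- a) = (- Fre a)%Re. Proof. exact: Fre_opp. Qed.
Lemma FimN a : Fim (- a) = (- Fim a)%Re. Proof. exact: Fim_opp. Qed.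
Lemma Fre_zero : Fre (0 : scal k) = R0. Proof. exact: Fre0. Qed.
Lemma Fim_zero : Fim (0 : scal k) = R0. Proof. exact: Fim0. Qed.
Lemma Fre_one : Fre (1 : scal k) = R1. Proof. exact: Fre1. Qed.
Lemma Fim_one : Fim (1 : scal k) = R0. Proof. exact: Fim1. Qed.

Definition FrE := (FreD, FimD, FreM, FimM, FreN, FimN, Fre_zero, Fim_zero,
                   Fre_one, Fim_one, Fre_conj, Fim_conj).

Lemma FnsqM a b : Fnsq (a * b) = (Fnsq a * Fnsq b)%Re.
Proof. rewrite /Fnsq !FrE; lra. Qed.

Lemma FnsqD_le a b : (Fnsq (a + b)%R <= 2 * Fnsq a + 2 * Fnsq b)%Re.
Proof.
rewrite /Fnsq !FrE.
have := Rle_0_sqr (Fre a - Fre b); have := Rle_0_sqr (Fim a - Fim b).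
rewrite /Rsqr; lra.
Qed.

Lemma Fre_mulconj a : Fre (a * Fconj a) = Fnsq a.
Proof. rewrite /Fnsq !FrE; lra. Qed.

Definition ofR (x : R) : scal k := Fmk x R0.

Lemma Fre_ofR x : Fre (ofR x) = x. Proof. exact: Fre_mk. Qed.
Lemma Fim_ofR x : Fim (ofR x) = R0. Proof. exact: Fim_mk. Qed.

Lemma ofR_inj : injective ofR.
Proof. by move=> x y /(congr1 (@Fre k)); rewrite !Fre_ofR. Qed.

Lemma ofRM x y : ofR (x * y)%Re = ofR x * ofR y.
Proof. by apply: scal_ext; rewrite !FrE !(Fre_ofR, Fim_ofR); lra. Qed.

Lemma ofRD x y : ofR (x + y)%Re = ofR x + ofR y.
Proof. by apply: scal_ext; rewrite !FrE !(Fre_ofR, Fim_ofR); lra. Qed.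

Lemma ofR1 : ofR R1 = 1.
Proof. by apply: scal_ext; rewrite ?(Fre_ofR, Fim_ofR) !FrE. Qed.

Lemma ofR0 : ofR R0 = 0.
Proof. by apply: scal_ext; rewrite ?(Fre_ofR, Fim_ofR) !FrE. Qed.

Lemma ofR_neq0 x : x <> R0 -> ofR x != 0.
Proof. by move=> x0; apply/eqP; rewrite -ofR0 => /ofR_inj. Qed.

Lemma ofRV x : x <> R0 -> ofR (/ x)%Re = (ofR x)^-1.
Proof.
move=> x0; apply: (mulIf (ofR_neq0 x0)); rewrite mulVf ?ofR_neq0 //.
by rewrite -ofRM Rinv_l // ofR1.
Qed.

Lemma Fconj_ofR x : Fconj (ofR x) = ofR x.
Proof. by apply: scal_ext; rewrite !FE ?(Fre_ofR, Fim_ofR); lra. Qed.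

Lemma Fnsq_ofR x : Fnsq (ofR x) = (x * x)%Re.
Proof. rewrite /Fnsq Fre_ofR Fim_ofR; lra. Qed.

End ScalarField.

(** * Polynomials up to equality of coefficients *)

Section LinearExtension.
Variables (k : fkind) (g : nat).
Implicit Types (p q r : ncpoly k g) (w u v : word g) (a b : scal k * word g).

(** Coefficients, matrix evaluations and truncations are all of this form, so one invariance result,
    [linext_peq], makes them independent of the chosen formal sum. *)
Definition linext (V : lmodType (scal k)) (f : word g -> V) p : V :=
  \sum_(t <- p) t.1 *: f t.2.

Definition peq p q := forall w, coef p w = coef q w.

Lemma coef_cons a p w :
  coef (a :: p) w = (if a.2 == w then a.1 else 0) + coef p w.
Proof. by rewrite [LHS]/=; case: ifP => _; rewrite ?add0r. Qed.

Lemma coef_nil w : coef (Nil (scal k * word g)) w = 0.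
Proof. by []. Qed.

Lemma coefE p w : coef p w = \sum_(t <- p) (if t.2 == w then t.1 else 0).
Proof. by elim: p => [|a p IH]; rewrite ?big_nil // big_cons coef_cons IH. Qed.

Lemma coef_cat p q w : coef (p ++ q) w = coef p w + coef q w.
Proof. by rewrite !coefE big_cat. Qed.

(** Collecting repeated words expresses the formal sum through [coef] alone; [s] may be any
    duplicate-free list covering the words, so two polynomials can share it. *)
Lemma linext_coef_on (V : lmodType (scal k)) (f : word g -> V) (s : seq (word g)) p :
  uniq s -> {subset [seq t.2 | t <- p] <= s} ->
  linext f p = \sum_(w <- s) coef p w *: f w.
Proof.
move=> us; elim: p => [|a p IH] sub.
  by rewrite /linext big_nil big1 // => w _; rewrite coef_nil scale0r.
rewrite /linext big_cons -/(linext f p) IH; last first.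
  by move=> w wp; apply: sub; rewrite inE wp orbT.
have as_ : a.2 \in s by apply: sub; rewrite inE eqxx.
under [RHS]eq_bigr do rewrite coef_cons scalerDl.
rewrite big_split /=; congr (_ + _).
rewrite (big_rem _ as_) /= eqxx big1_seq ?addr0 // => w /andP[_].
by rewrite mem_rem_uniq // inE eq_sym => /andP[/negbTE -> _]; rewrite scale0r.
Qed.

Lemma linext_peq (V : lmodType (scal k)) (f : word g -> V) p q :
  peq p q -> linext f p = linext f q.
Proof.
move=> pq; pose s := undup ([seq t.2 | t <- p] ++ [seq t.2 | t <- q]).
rewrite (@linext_coef_on _ f s p) ?undup_uniq //; last first.
  by move=> w wp; rewrite mem_undup mem_cat wp.
rewrite (@linext_coef_on _ f s q) ?undup_uniq //; last first.
  by move=> w wp; rewrite mem_undup mem_cat wp orbT.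
by apply: eq_bigr => w _; rewrite pq.
Qed.

Lemma linext_eq0 (V : lmodType (scal k)) (f : word g -> V) p :
  (forall w, coef p w <> 0 -> f w = 0) -> linext f p = 0.
Proof.
move=> f0; rewrite (@linext_coef_on _ f (undup [seq t.2 | t <- p])) ?undup_uniq //.
  apply: big1 => w _; case: (eqVneq (coef p w) 0) => [->|/eqP /f0 ->];
  by rewrite ?scale0r ?scaler0.
by move=> w; rewrite mem_undup.
Qed.

Lemma linext_eq (V : lmodType (scal k)) (f1 f2 : word g -> V) p :
  (forall w, coef p w <> 0 -> f1 w = f2 w) -> linext f1 p = linext f2 p.
Proof.
move=> f12; apply/eqP; rewrite -subr_eq0 /linext -sumrB; apply/eqP.
under eq_bigr do rewrite -scalerBr.
by apply: (@linext_eq0 _ (fun w => f1 w - f2 w)) => w /f12 ->; rewrite subrr.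
Qed.

Lemma linext_cat (V : lmodType (scal k)) (f : word g -> V) p q :
  linext f (p ++ q) = linext f p + linext f q.
Proof. by rewrite /linext big_cat. Qed.

Lemma linext1 (V : lmodType (scal k)) (f : word g -> V) a :
  linext f [:: a] = a.1 *: f a.2.
Proof. by rewrite /linext big_seq1. Qed.

Lemma linext_pmul (V : lmodType (scal k)) (f : word g -> V) p q :
  linext f (pmul p q) = linext (fun u => linext (fun v => f (u ++ v)) q) p.
Proof.
rewrite /linext /pmul big_allpairs_dep; apply: eq_bigr => t _.
by rewrite scaler_sumr; apply: eq_bigr => t' _; rewrite scalerA.
Qed.

Lemma coef_linext p w : coef p w = linext (fun u => (u == w)%:R : (scal k)^o) p.
Proof.
rewrite coefE; apply: eq_bigr => t _; rewrite /GRing.scale /=.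
by case: eqP; rewrite ?mulr1 ?mulr0.
Qed.

Lemma peq_linext p q :
  (forall f : word g -> (scal k)^o, linext f p = linext f q) -> peq p q.
Proof. by move=> pq w; rewrite !coef_linext pq. Qed.

Lemma peq_pmul p p' q q' : peq p p' -> peq q q' -> peq (pmul p q) (pmul p' q').
Proof.
move=> pp' qq'; apply: peq_linext => f; rewrite !linext_pmul (linext_peq _ pp').
by apply: linext_eq => w _; apply: linext_peq.
Qed.

Lemma pmulA p q r : peq (pmul p (pmul q r)) (pmul (pmul p q) r).
Proof.
apply: peq_linext => f; rewrite !linext_pmul; apply: linext_eq => u _.
rewrite linext_pmul; apply: linext_eq => v _; apply: linext_eq => w _.
by rewrite catA.
Qed.

Lemma pmul_catl p q r : pmul (p ++ q) r = pmul p r ++ pmul q r.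
Proof. exact: allpairs_cat. Qed.

Lemma pmul_catr p q r : peq (pmul p (q ++ r)) (pmul p q ++ pmul p r).
Proof.
apply: peq_linext => f; rewrite linext_cat !linext_pmul /linext -big_split /=.
by apply: eq_bigr => t _; rewrite big_cat scalerDr.
Qed.

Lemma pmul0 p : pmul p [::] = [::].
Proof. by elim: p. Qed.

Definition pconst (c : scal k) : ncpoly k g := [:: (c, [::])].

Lemma linext_const_mul (V : lmodType (scal k)) (f : word g -> V) c p :
  linext f (pmul (pconst c) p) = c *: linext f p.
Proof. by rewrite linext_pmul linext1. Qed.

Lemma coef_const_mul c p w : coef (pmul (pconst c) p) w = c * coef p w.
Proof. by rewrite !coef_linext linext_const_mul. Qed.

Lemma wstarK : involutive (@wstar g).
Proof.
move=> w; rewrite /wstar -map_rev revK -map_comp -[RHS]map_id; apply: eq_map.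
by case=> j b; rewrite /= /lstar /= negbK.
Qed.

Lemma linext_pstar (V : lmodType (scal k)) (f : word g -> V) p :
  linext f (pstar p) = \sum_(t <- p) Fconj t.1 *: f (wstar t.2).
Proof. by rewrite /linext big_map. Qed.

Lemma coef_pstar p w : coef (pstar p) w = Fconj (coef p (wstar w)).
Proof.
rewrite !coefE big_map rmorph_sum; apply: eq_bigr => t _ /=.
rewrite -(inj_eq (can_inj wstarK)) wstarK; case: eqP => _ //.
by rewrite rmorph0.
Qed.

Lemma homogeneous_star p : homogeneous p -> homogeneous (pstar p).
Proof.
case=> d hd; exists d => w; rewrite coef_pstar => nz.
have <- : size (wstar w) = size w by rewrite /wstar size_rev size_map.
by apply: hd => z; apply: nz; rewrite z (rmorph0 (@Fconj k)).
Qed.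

(** Acts on the homogeneous component of degree d as the scalar [h d]. Powers of c give the dilation
    of all letters by c; the indicator of d <= N gives truncation. *)
Definition degscale (h : nat -> scal k) p : ncpoly k g :=
  [seq (h (size t.2) * t.1, t.2) | t <- p].

Lemma linext_degscale (V : lmodType (scal k)) (f : word g -> V) h p :
  linext f (degscale h p) = linext (fun w => h (size w) *: f w) p.
Proof.
by rewrite /linext big_map; apply: eq_bigr => t _; rewrite scalerA mulrC.
Qed.

Lemma degscale_cat h p q : degscale h (p ++ q) = degscale h p ++ degscale h q.
Proof. exact: map_cat. Qed.

Lemma coef_degscale h p w : coef (degscale h p) w = h (size w) * coef p w.
Proof.
rewrite !coefE big_map mulr_sumr; apply: eq_bigr => t _ /=.
by case: eqP => [->|_] //; rewrite mulr0.
Qed.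

End LinearExtension.

(** * The star-ideal and its grading *)

Section StarIdeal.
Variables (k : fkind) (g : nat) (S : ncpoly k g -> Prop).
Implicit Types (p q r : ncpoly k g) (w u v : word g).
Local Notation mem := (in_star_ideal S).

Lemma ideal_peq p q : peq p q -> mem p -> mem q.
Proof. by move=> pq [l [lS lp]]; exists l; split=> // w; rewrite -pq. Qed.

Lemma ideal_nil : mem [::].
Proof. by exists [::]; split; first exact: List.Forall_nil. Qed.

Lemma ideal_cat p q : mem p -> mem q -> mem (p ++ q).
Proof.
move=> [l [lS lp]] [l' [lS' lp']]; exists (l ++ l'); split.
  by apply/List.Forall_app.
by move=> w; rewrite map_cat flatten_cat !coef_cat lp lp'.
Qed.

Lemma ideal_gen t : S t.1.1.2 -> mem (gen_term t).
Proof.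
move=> tS; exists [:: t]; split; last by move=> w; rewrite /= cats0.
by apply: List.Forall_cons => //; apply: List.Forall_nil.
Qed.

Lemma ideal_sub s (e : bool) : S s -> mem (if e then pstar s else s).
Proof.
move=> sS; apply: ideal_peq (ideal_gen (t := (pconst g 1, s, pconst g 1, e)) sS).
apply: peq_linext => f; rewrite linext_pmul linext_const_mul scale1r.
apply: linext_eq => u _.
by rewrite linext1 scale1r cats0.
Qed.

Lemma ideal_ind (P : ncpoly k g -> Prop) :
  (forall p q, peq p q -> P p -> P q) -> P [::] ->
  (forall p q, P p -> P q -> P (p ++ q)) ->
  (forall t, S t.1.1.2 -> P (gen_term t)) -> forall p, mem p -> P p.
Proof.
move=> Peq P0 Pcat Pgen p [l [lS lp]].
apply: (Peq (flatten (map (@gen_term k g) l))) => [w|]; first by rewrite lp.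
elim: lS => //= t l' tS _ IH; apply: Pcat => //; exact: Pgen.
Qed.

Lemma ideal_pmull r p : mem p -> mem (pmul r p).
Proof.
move: p; apply: ideal_ind => [p q pq||p q mp mq|[[[a s] b] e] /= sS].
- by apply: ideal_peq; apply: peq_pmul.
- rewrite pmul0; exact: ideal_nil.
- apply: ideal_peq (ideal_cat mp mq) => w; exact/esym/pmul_catr.
- apply: ideal_peq (ideal_gen (t := (pmul r a, s, b, e)) sS) => w /=.
  rewrite /gen_term /= [RHS]pmulA; apply: peq_pmul => // u.
  exact/esym/pmulA.
Qed.

Lemma ideal_pmulr r p : mem p -> mem (pmul p r).
Proof.
move: p; apply: ideal_ind => [p q pq||p q mp mq|[[[a s] b] e] /= sS].
- by apply: ideal_peq; apply: peq_pmul.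
- exact: ideal_nil.
- rewrite pmul_catl; exact: ideal_cat.
- apply: ideal_peq (ideal_gen (t := (a, s, pmul b r, e)) sS) => w.
  by rewrite /gen_term /= pmulA.
Qed.

Hypothesis S_hom : forall q, S q -> homogeneous q.

                                                                          
                                                                  
(** This is the gradedness of the ideal. By bilinearity it suffices to treat a generator or its star
    between two monomials; that product is homogeneous, so [h] acts on it as one scalar. *)
Lemma ideal_degscale (h : nat -> scal k) p : mem p -> mem (degscale h p).
Proof.
move: p; apply: ideal_ind => [p q pq||p q mp mq|[[[x s] y] e] /= sS].
- by apply: ideal_peq => w; rewrite !coef_degscale pq.
- exact: ideal_nil.
- rewrite degscale_cat; exact: ideal_cat.
rewrite /gen_term /=; set s' := if e then _ else _.
elim: x => [|a x IHx]; first exact: ideal_nil.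
rewrite -(cat1s a x) (pmul_catl [:: a]) pmul_catl degscale_cat; apply: ideal_cat => //.
elim: y {IHx} => [|b y IHy]; first by rewrite pmul0; exact: ideal_nil.
suff mb : mem (degscale h (pmul (pmul [:: a] s') [:: b])).
  apply: ideal_peq (ideal_cat mb IHy) => w; rewrite -[b :: y]cat1s.
  by rewrite coef_cat !coef_degscale pmul_catr coef_cat mulrDr.
have [d hd] : homogeneous s'.
  by rewrite /s'; case: (e); [apply: homogeneous_star|]; apply: S_hom.
(* The degree of the product; coefficients at words of any other length vanish. *)
pose D := (size a.2 + d + size b.2)%N.
apply: (@ideal_peq (pmul (pconst g (h D)) (pmul (pmul [:: a] s') [:: b]))); last first.
  exact/ideal_pmull/(ideal_gen (t := ([:: a], s, [:: b], e))).
move=> w; rewrite coef_const_mul coef_degscale.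
case: (eqVneq (size w) D) => [-> //|wD].
suff -> : coef (pmul (pmul [:: a] s') [:: b]) w = 0 by rewrite !mulr0.
rewrite coef_linext !linext_pmul linext1.
rewrite linext_eq0 ?scaler0 // => v /hd vd.
rewrite linext1; case: eqP => [ww|]; last by rewrite scaler0.
by move: wD; rewrite -ww !size_cat vd eqxx.
Qed.

End StarIdeal.

(** * Evaluation at pairs of matrix tuples *)

Section MatrixEvaluation.
Variables (k : fkind) (g : nat).
Implicit Types (p q : ncpoly k g) (w u v : word g).
Local Notation K := (scal k).

Definition dagger m n (X : 'M[K]_(m, n)) : 'M[K]_(n, m) := map_mx (@Fconj k) X^T.

Lemma daggerK m n (X : 'M[K]_(m, n)) : dagger (dagger X) = X.
Proof. by apply/matrixP => i j; rewrite !mxE FconjK. Qed.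

Lemma daggerM m n r (X : 'M[K]_(m, n)) (Y : 'M[K]_(n, r)) :
  dagger (X *m Y) = dagger Y *m dagger X.
Proof. by rewrite /dagger trmx_mul map_mxM. Qed.

Lemma daggerD m n (X Y : 'M[K]_(m, n)) : dagger (X + Y) = dagger X + dagger Y.
Proof. by rewrite /dagger linearD map_mxD. Qed.

Lemma daggerN m n (X : 'M[K]_(m, n)) : dagger (- X) = - dagger X.
Proof. by rewrite /dagger linearN map_mxN. Qed.

Lemma dagger0 m n : dagger (0 : 'M[K]_(m, n)) = 0.
Proof. by rewrite /dagger trmx0 map_mx0. Qed.

Lemma dagger1 n : dagger (1%:M : 'M[K]_n) = 1%:M.
Proof. by rewrite /dagger trmx1 map_mx1. Qed.

Lemma daggerZ m n c (X : 'M[K]_(m, n)) : dagger (c *: X) = Fconj c *: dagger X.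
Proof. by rewrite /dagger linearZ map_mxZ. Qed.

(** The starred letters go to an arbitrary tuple [Xs], not necessarily the adjoints of [X]: the
    quotient matrices and the tuple [Yd] require this freedom. *)
Definition wordmx n (X Xs : 'I_g -> 'M[K]_n) w : 'M[K]_n :=
  eval_word k 1%:M (@mulmx _ n n n) X Xs w.

Definition mxeval n (X Xs : 'I_g -> 'M[K]_n) p := linext (wordmx X Xs) p.

Definition letmx n (X Xs : 'I_g -> 'M[K]_n) (l : letter g) :=
  if l.2 then Xs l.1 else X l.1.

Lemma wordmx_cons n (X Xs : 'I_g -> 'M[K]_n) l w :
  wordmx X Xs (l :: w) = letmx X Xs l *m wordmx X Xs w.
Proof. by []. Qed.

Lemma wordmx_cat n (X Xs : 'I_g -> 'M[K]_n) u v :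
  wordmx X Xs (u ++ v) = wordmx X Xs u *m wordmx X Xs v.
Proof.
elim: u => [|l u IH]; first by rewrite mul1mx.
by rewrite cat_cons !wordmx_cons IH mulmxA.
Qed.

Lemma wordmx_rcons n (X Xs : 'I_g -> 'M[K]_n) u l :
  wordmx X Xs (rcons u l) = wordmx X Xs u *m letmx X Xs l.
Proof. by rewrite -cats1 wordmx_cat /wordmx /= mulmx1. Qed.

Lemma mxeval_pmul n (X Xs : 'I_g -> 'M[K]_n) p q :
  mxeval X Xs (pmul p q) = mxeval X Xs p *m mxeval X Xs q.
Proof.
rewrite /mxeval linext_pmul {1 3}/linext mulmx_suml; apply: eq_bigr => t _.
rewrite -scalemxAl; congr (_ *: _); rewrite /linext mulmx_sumr.
by apply: eq_bigr => t' _; rewrite wordmx_cat scalemxAr.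
Qed.

Lemma mxeval_ideal n (X Xs : 'I_g -> 'M[K]_n) (S : ncpoly k g -> Prop) :
  (forall s, S s -> mxeval X Xs s = 0) ->
  (forall s, S s -> mxeval X Xs (pstar s) = 0) ->
  forall q, in_star_ideal S q -> mxeval X Xs q = 0.
Proof.
move=> S0 Ss0; apply: ideal_ind => [p q pq||p q p0 q0|[[[a s] b] e] /= sS].
- by rewrite /mxeval (linext_peq _ pq).
- by rewrite /mxeval /linext big_nil.
- by rewrite /mxeval linext_cat -!/(mxeval _ _ _) p0 q0 addr0.
- rewrite /gen_term !mxeval_pmul /=.
  by case: e; rewrite ?(S0 _ sS) ?(Ss0 _ sS) mulmx0 mul0mx.
Qed.

(** With [D] rectangular this covers passage to a quotient, restriction to an invariant subspace and
    similarity alike. *)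
Lemma mxeval_intertwine m n (X Xs : 'I_g -> 'M[K]_m) (Y Ys : 'I_g -> 'M[K]_n)
    (D : 'M[K]_(m, n)) p :
  (forall j, X j *m D = D *m Y j) -> (forall j, Xs j *m D = D *m Ys j) ->
  mxeval X Xs p *m D = D *m mxeval Y Ys p.
Proof.
move=> XD XsD; rewrite /mxeval /linext mulmx_suml mulmx_sumr.
apply: eq_bigr => t _; rewrite -scalemxAl -scalemxAr; congr (_ *: _).
elim: t.2 => [|[j b] w IH]; first by rewrite /wordmx /= mul1mx mulmx1.
rewrite !wordmx_cons -mulmxA IH !mulmxA; congr (_ *m _).
by rewrite /letmx /=; case: b.
Qed.

Lemma mxeval_analytic n (X Xs Xs' : 'I_g -> 'M[K]_n) p :
  analytic p -> mxeval X Xs p = mxeval X Xs' p.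
Proof.
move=> an; apply: linext_eq => w /an.
elim: w => [//|[j b] w IH]; rewrite [all _ _]/= => /andP[/negbTE nb aw].
by rewrite !wordmx_cons IH // /letmx /= nb.
Qed.

Lemma wordmx_star n (X Xs : 'I_g -> 'M[K]_n) w :
  dagger (wordmx X Xs w) =
  wordmx (fun j => dagger (Xs j)) (fun j => dagger (X j)) (wstar w).
Proof.
elim: w => [|[j b] w IH]; first exact: dagger1.
rewrite wordmx_cons daggerM IH /wstar /= rev_cons wordmx_rcons; congr (_ *m _).
by rewrite /letmx /=; case: b.
Qed.

Lemma mxeval_star n (X Xs : 'I_g -> 'M[K]_n) p :
  dagger (mxeval X Xs p) =
  mxeval (fun j => dagger (Xs j)) (fun j => dagger (X j)) (pstar p).
Proof.
rewrite /mxeval linext_pstar /linext.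
rewrite (big_morph (@dagger n n) (@daggerD n n) (dagger0 n n)).
by apply: eq_bigr => t _; rewrite daggerZ wordmx_star.
Qed.

Lemma mxeval_dilate n (X Xs : 'I_g -> 'M[K]_n) c p :
  mxeval (fun j => c *: X j) (fun j => c *: Xs j) p =
  mxeval X Xs (degscale (fun d => c ^+ d) p).
Proof.
rewrite /mxeval linext_degscale; apply: linext_eq => w _.
elim: w => [|l w IH]; first by rewrite scale1r.
rewrite !wordmx_cons IH exprS -scalemxAr -scalerA.
have -> : letmx (fun j => c *: X j) (fun j => c *: Xs j) l = c *: letmx X Xs l.
  by rewrite /letmx; case: ifP.
by rewrite -scalemxAl !scalerA mulrC.
Qed.

End MatrixEvaluation.

(** * Truncated quotients of the free algebra *)

Section FiniteQuotient.

(** Take a matrix of maximal rank whose row space lies in [J]; a vector of [J] outside that row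
    space could be adjoined to raise the rank. *)
Lemma subspace_matrix (F : fieldType) (m : nat) (J : 'rV[F]_m -> Prop) :
  J 0 -> (forall u v, J u -> J v -> J (u + v)) -> (forall c u, J u -> J (c *: u)) ->
  exists B : 'M[F]_m, forall v, J v <-> (v <= B)%MS.
Proof.
move=> J0 JD JZ.
pose good r := `[< exists B : 'M[F]_m,
  \rank B = r /\ forall v : 'rV_m, (v <= B)%MS -> J v >].
have ex : exists r, good r.
  exists 0%N; apply/asboolP; exists 0; split=> [|v]; first exact: mxrank0.
  by rewrite submx0 => /eqP ->.
have ub r : good r -> (r <= m)%N by move=> /asboolP[B [<- _]]; exact: rank_leq_row.
case: (ex_maxnP ex ub) => r /asboolP[B [rB BJ]] rmax.
exists B => v; split=> [Jv|]; last exact: BJ.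
apply: contraT => vB.
have /rmax : good (\rank (B + v)%MS).
  apply/asboolP; exists (B + v)%MS; split=> // w /sub_addsmxP[[a b] /= ->].
  apply: JD; first exact/BJ/submxMl.
  by rewrite [b]mx11_scalar mul_scalar_mx; apply: JZ.
rewrite -rB leqNgt; suff -> : (\rank B < \rank (B + v)%MS)%N by [].
apply: rank_ltmx; rewrite ltmxE addsmxSl /=.
by apply: contra vB => /(submx_trans (addsmxSr _ _)).
Qed.

(** [D] is the projection onto the quotient by [J] and [E] a linear section of it; both come from a
    rank factorization of the cokernel matrix. *)
Lemma quotient_matrix (F : fieldType) (m : nat) (J : 'rV[F]_m -> Prop) :
  J 0 -> (forall u v, J u -> J v -> J (u + v)) -> (forall c u, J u -> J (c *: u)) ->
  exists n (D : 'M[F]_(m, n)) (E : 'M[F]_(n, m)),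
    E *m D = 1%:M /\ forall v, J v <-> v *m D = 0.
Proof.
move=> J0 JD JZ; have [B BJ] := subspace_matrix J0 JD JZ.
have [E ED] := row_fullP (col_base_full (cokermx B)).
exists _, (col_base (cokermx B)), E; split=> // v.
rewrite BJ submxE -{1}(mulmx_base (cokermx B)) mulmxA; split=> [/eqP v0|->].
  by apply: (row_free_inj (row_base_free (cokermx B))); rewrite v0 mul0mx.
by rewrite mul0mx.
Qed.

Variables (k : fkind) (g : nat) (S : ncpoly k g -> Prop).
Hypothesis S_hom : forall q, S q -> homogeneous q.
Variable N : nat.
Local Notation K := (scal k).
Local Notation W := {bseq N of letter g}.

(** A basis vector if the length of [w] is at most [N] and zero otherwise, so that [polyvec] is
    truncation at degree [N]. *)
Definition wordvec (w : word g) : 'rV[K]_#|{: W}| :=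
  \row_j (bseqval (enum_val j) == w)%:R.

(** Right multiplication by [l]. Matrices act on row vectors from the right, so a product of
    matrices appends letters in reading order. *)
Definition rmulmx (l : letter g) : 'M[K]_#|{: W}| :=
  \matrix_i wordvec (rcons (bseqval (enum_val i)) l).

Definition polyvec : ncpoly k g -> 'rV[K]_#|{: W}| := linext wordvec.

Lemma wordvec_delta (x : W) : wordvec x = delta_mx 0 (enum_rank x).
Proof.
apply/rowP => j; rewrite !mxE eqxx -(inj_eq enum_val_inj) enum_rankK.
by rewrite -(inj_eq val_inj).
Qed.

Lemma wordvec_long w : (N < size w)%N -> wordvec w = 0.
Proof.
move=> lt; apply/rowP => j; rewrite !mxE; case: eqP => // jw.
by move: lt; rewrite -jw ltnNge size_bseq.
Qed.

Lemma wordvec_rmul w l : wordvec w *m rmulmx l = wordvec (rcons w l).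
Proof.
have [wN|wN] := leqP (size w) N; last first.
  by rewrite !wordvec_long ?mul0mx // size_rcons ltnW.
rewrite (wordvec_delta (Bseq wN)) -rowE.
by apply/rowP => j; rewrite !mxE enum_rankK.
Qed.

Definition rmulL j := rmulmx (j, false).
Definition rmulR j := rmulmx (j, true).

Lemma wordvec_wordmx w u : wordvec w *m wordmx rmulL rmulR u = wordvec (w ++ u).
Proof.
elim: u w => [|[j b] u IH] w; first by rewrite /wordmx /= mulmx1 cats0.
rewrite wordmx_cons mulmxA.
have -> : letmx rmulL rmulR (j, b) = rmulmx (j, b) by rewrite /letmx; case: b.
by rewrite wordvec_rmul IH cat_rcons.
Qed.

Lemma wordvec_mxeval w p :
  wordvec w *m mxeval rmulL rmulR p = polyvec (pmul [:: (1, w)] p).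
Proof.
rewrite /polyvec linext_pmul linext1 scale1r.
rewrite /mxeval /linext mulmx_sumr; apply: eq_bigr => t _.
by rewrite -scalemxAr wordvec_wordmx.
Qed.

Lemma polyvec_rmul p l : polyvec p *m rmulmx l = polyvec (pmul p [:: (1, [:: l])]).
Proof.
rewrite /polyvec linext_pmul /linext mulmx_suml; apply: eq_bigr => t _.
by rewrite big_seq1 scale1r -scalemxAl wordvec_rmul cats1.
Qed.

Lemma polyvec_coef p (x : W) : polyvec p 0 (enum_rank x) = coef p x.
Proof.
rewrite /polyvec /linext summxE coefE; apply: eq_bigr => t _.
rewrite !mxE enum_rankK eq_sym.
by case: eqP => _; rewrite ?mulr1 ?mulr0.
Qed.

(** The truncated ideal [J] is stable under right multiplication, which therefore descends to
    matrices [A], [C] on the quotient. Left multiples of elements of the ideal stay in it, whence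
    the first claim; the second tests p(A,C) on the class of the empty word and uses the grading. *)
Lemma finite_quotient :
  exists n (A C : 'I_g -> 'M[K]_n),
    (forall q, in_star_ideal S q -> mxeval A C q = 0) /\
    (forall p, (forall w, coef p w <> 0 -> (size w <= N)%N) ->
       mxeval A C p = 0 -> in_star_ideal S p).
Proof.
pose J v := exists2 p, in_star_ideal S p & v = polyvec p.
have J0 : J 0 by exists [::]; [exact: ideal_nil|rewrite /polyvec /linext big_nil].
have JD u v : J u -> J v -> J (u + v).
  move=> [p mp ->] [q mq ->]; exists (p ++ q); first exact: ideal_cat.
  by rewrite /polyvec linext_cat.
have JZ c u : J u -> J (c *: u).
  move=> [p mp ->]; exists (pmul (pconst g c) p); first exact: ideal_pmull.
  by rewrite /polyvec linext_const_mul.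
have [n [D [E [ED JE]]]] := quotient_matrix J0 JD JZ.
have Jrow (m : nat) (Z : 'M_(m, _)) : (forall i, J (row i Z)) -> Z *m D = 0.
  by move=> ZJ; apply/row_matrixP => i; rewrite row_mul row0; apply/JE.
(* The rows of 1 - DE are killed by [D], hence lie in [J], and right multiplication by [l] keeps
   them there. *)
have rmulD l : rmulmx l *m D = D *m (E *m rmulmx l *m D).
  have : (1%:M - D *m E) *m rmulmx l *m D = 0.
    apply: Jrow => i; rewrite row_mul.
    have /JE [p mp ->] : row i (1%:M - D *m E) *m D = 0.
      by rewrite -row_mul mulmxBl mul1mx -mulmxA ED mulmx1 subrr row0.
    by rewrite polyvec_rmul; exists (pmul p [:: (1, [:: l])]) => //; apply: ideal_pmulr.
  by rewrite !mulmxBl mul1mx !mulmxA => /subr0_eq.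
pose A j := E *m rmulL j *m D; pose C j := E *m rmulR j *m D.
have evD p : mxeval rmulL rmulR p *m D = D *m mxeval A C p.
  by apply: mxeval_intertwine => j; apply: rmulD.
exists n, A, C; split=> [q mq | p pN p0].
  (* Row i of the upstairs value of q is the truncation of the i-th word times q. *)
  rewrite -[mxeval A C q]mul1mx -ED -mulmxA -evD Jrow ?mulmx0 // => i.
  rewrite rowE -(enum_valK i) -wordvec_delta wordvec_mxeval.
  by exists (pmul [:: (1, bseqval (enum_val i))] q) => //; apply: ideal_pmull.
(* The class of the empty word, multiplied by p(A,C), is the class of p. *)
have /JE [q mq] : polyvec p *m D = 0.
  have := wordvec_mxeval [::] p.
  have -> : polyvec (pmul [:: (1, [::])] p) = polyvec p.
    by rewrite /polyvec (linext_const_mul _ 1) scale1r.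
  by move=> <-; rewrite -mulmxA evD p0 !mulmx0.
(* Since p has no words longer than [N], it equals the truncation of q, which the graded ideal
   contains. *)
move=> pq; apply: ideal_peq (ideal_degscale S_hom (fun d => (d <= N)%N%:R) mq) => w.
rewrite coef_degscale; have [wN|wN] := leqP (size w) N.
  rewrite mul1r; have := congr1 (fun v : 'rV_ _ => v 0 (enum_rank (Bseq wN))) pq.
  by rewrite !polyvec_coef.
rewrite mul0r; apply/esym/eqP; apply: contraTT wN => /eqP /pN.
by rewrite -leqNgt.
Qed.

End FiniteQuotient.

(** * Laurent polynomials as functions *)

Section LaurentFunctions.
Variable F : fieldType.
Implicit Types (f : F -> F) (s z : F).

(** A power of s clears the pole at 0; the value of [f] at 0 itself is left unconstrained. *)
Definition laurent f :=
  exists L (q : {poly F}), forall s, s != 0 -> s ^+ L * f s = q.[s].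

Lemma laurent_cst c : laurent (fun _ => c).
Proof. by exists 0%N, c%:P => s _; rewrite mul1r hornerC. Qed.

Lemma laurent_id : laurent id.
Proof. by exists 0%N, 'X => s _; rewrite mul1r hornerX. Qed.

Lemma laurent_inv : laurent (fun s => s^-1).
Proof. by exists 1%N, 1 => s s0; rewrite mulfV // hornerC. Qed.

Lemma laurentD f1 f2 : laurent f1 -> laurent f2 -> laurent (fun s => f1 s + f2 s).
Proof.
move=> [L1 [q1 e1]] [L2 [q2 e2]]; exists (L1 + L2)%N, ('X^L2 * q1 + 'X^L1 * q2) => s s0.
rewrite hornerD !hornerM !hornerXn -e1 // -e2 // mulrDr exprD !mulrA.
by rewrite [s ^+ L2 * _]mulrC.
Qed.

Lemma laurentM f1 f2 : laurent f1 -> laurent f2 -> laurent (fun s => f1 s * f2 s).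
Proof.
move=> [L1 [q1 e1]] [L2 [q2 e2]]; exists (L1 + L2)%N, (q1 * q2) => s s0.
by rewrite hornerM -e1 // -e2 // exprD mulrACA.
Qed.

Lemma laurent_sum (I : Type) (r : seq I) (f : I -> F -> F) :
  (forall i, laurent (f i)) -> laurent (fun s => \sum_(i <- r) f i s).
Proof.
move=> lf; elim: r => [|i r IH].
  by under eq_fun do rewrite big_nil; apply: laurent_cst.
by under eq_fun do rewrite big_cons; apply: laurentD.
Qed.

(** After clearing the pole, a nonzero polynomial [q] has fewer than [size q] roots, so the first
    [size q] points cannot all be zeros. *)
Lemma laurent_neq0 f z (x : nat -> F) :
  laurent f -> z != 0 -> f z != 0 -> injective x -> (forall m, x m != 0) ->
  exists m, f (x m) != 0.
Proof.
move=> [L [q e]] z0 fz xinj x0; apply: contrapT => /forallNP fx.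
have q0 : q != 0.
  apply/eqP => q0; have := e z z0; rewrite q0 horner0 => /eqP.
  by rewrite mulf_eq0 expf_eq0 (negbTE z0) (negbTE fz) andbF.
pose rs := [seq x m | m <- iota 0 (size q)].
have rq : all (root q) rs.
  apply/allP => _ /mapP[m _ ->]; rewrite rootE -e //.
  by have /negP/negPn/eqP -> := fx m; rewrite mulr0.
have := max_poly_roots q0 rq; rewrite map_inj_uniq // iota_uniq.
by rewrite size_map size_iota ltnn => /(_ isT).
Qed.

End LaurentFunctions.

(** * The doubling trick *)

Section Doubling.
Variables (k : fkind) (g n : nat).
Local Notation K := (scal k).
Variables (A C : 'I_g -> 'M[K]_n).

Lemma laurent_mxeval m (X Xs : K -> 'I_g -> 'M[K]_m) p :
  (forall j a b, laurent (fun s => X s j a b)) ->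
  (forall j a b, laurent (fun s => Xs s j a b)) ->
  forall a b, laurent (fun s => mxeval (X s) (Xs s) p a b).
Proof.
move=> lX lXs a b; under eq_fun do rewrite /mxeval /linext summxE.
apply: laurent_sum => -[c w] /=.
under eq_fun do rewrite mxE; apply: laurentM; first exact: laurent_cst.
elim: w a b => [|[j e] w IH] a b; first by apply: laurent_cst.
under eq_fun do rewrite wordmx_cons mxE.
apply: laurent_sum => i; apply: laurentM => //.
by rewrite /letmx /=; case: e.
Qed.

Definition Fhalf : K := ofR k (/ 2)%Re.

Lemma Fhalf_double : Fhalf + Fhalf = 1.
Proof. by rewrite /Fhalf -ofRD -ofR1; congr ofR; lra. Qed.

(** If [C] were the adjoint of [A], then [Bm] would be [A] and [Qm] would vanish; [Qm] measures the
    failure. *)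
Definition Bm j := dagger (C j).
Definition Pm j := Fhalf *: (A j + Bm j).
Definition Qm j := Fhalf *: (A j - Bm j).

Lemma PmDQm j : Pm j + Qm j = A j.
Proof.
rewrite /Pm /Qm -scalerDr addrACA subrr addr0 -[A j in LHS]scale1r -scalerDl.
by rewrite scalerA mulrDr mulr1 Fhalf_double scale1r.
Qed.

Lemma PmBQm j : Pm j - Qm j = Bm j.
Proof.
rewrite /Pm /Qm -scalerBr opprB [A j + _ + _]addrC addrA subrK -[Bm j in LHS]scale1r.
by rewrite -scalerDl scalerA mulrDr mulr1 Fhalf_double scale1r.
Qed.

(** For t nonzero, the direct sum of [A] and [Bm] conjugated by the matrix with rows (t, t) and (1,
    -1). *)
Definition Xd (t : K) j : 'M[K]_(n + n) :=
  block_mx (Pm j) (t *: Qm j) (t^-1 *: Qm j) (Pm j).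

                                                                                           
(** For s = t^2 with t real and nonzero, what the adjoint of [Xd t] becomes under the conjugation
    taking [Xd t] to [Xd 1]. Unlike that adjoint, it also makes sense at s = -1. *)
Definition Yd (s : K) j : 'M[K]_(n + n) :=
  block_mx (dagger (Pm j)) (s^-1 *: dagger (Qm j)) (s *: dagger (Qm j)) (dagger (Pm j)).

Lemma dagger_Xd (x : R) j : x <> R0 ->
  dagger (Xd (ofR k x) j) =
  block_mx (dagger (Pm j)) ((ofR k x)^-1 *: dagger (Qm j))
           (ofR k x *: dagger (Qm j)) (dagger (Pm j)).
Proof.
move=> x0; rewrite /dagger /Xd tr_block_mx map_block_mx -!/(dagger _).
by rewrite !daggerZ -ofRV // !Fconj_ofR.
Qed.

(** The columns (t, 1) and (t, -1) intertwine [Xd t] with [A] and [Bm]. As q vanishes at both, its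
    value at [Xd t] kills an invertible matrix. *)
Lemma mxeval_Xd_analytic (t : K) (Xs : 'I_g -> 'M[K]_(n + n)) q : t != 0 -> analytic q ->
  mxeval A C q = 0 -> mxeval A C (pstar q) = 0 -> mxeval (Xd t) Xs q = 0.
Proof.
move=> t0 an q0 qs0; rewrite (mxeval_analytic _ Xs (Xd t) an).
set Z := mxeval _ _ q.
have ZA : Z *m col_mx t%:M 1%:M = 0.
  rewrite /Z (@mxeval_intertwine _ _ _ _ _ _ A A) => [|j|j].
  - by rewrite (mxeval_analytic _ A C an) q0 mulmx0.
  1,2: rewrite mul_block_col mul_col_mx mul1mx mul_scalar_mx !mulmx1 !mul_mx_scalar.
  1,2: by rewrite -scalerDr scalerA mulfV // scale1r [Qm j + _]addrC PmDQm.
have ZB : Z *m col_mx t%:M (- 1%:M) = 0.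
  rewrite /Z (@mxeval_intertwine _ _ _ _ _ _ Bm Bm) => [|j|j].
  (* Choosing the adjoints of [A] for the starred letters makes q(Bm) the adjoint of the value of
     [pstar q] at (A,C). *)
  - rewrite (mxeval_analytic _ Bm (fun j => dagger (A j)) an).
    rewrite -[mxeval Bm _ q]daggerK mxeval_star /=.
    under eq_fun do rewrite daggerK.
    under [X in mxeval _ X]eq_fun do rewrite daggerK.
    by rewrite qs0 dagger0 mulmx0.
  1,2: rewrite mul_block_col mul_col_mx mulNmx mul1mx mul_scalar_mx !mulmxN !mulmx1.
  1,2: rewrite !mul_mx_scalar -scalerBr scalerA mulfV // scale1r -[Qm j - _]opprB.
  1,2: by rewrite PmBQm.
have ZZ : Z *m block_mx t%:M t%:M 1%:M (- 1%:M) = 0.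
  by rewrite block_mxEh mul_mx_row ZA ZB row_mx0.
rewrite -[Z]mulmx1.
(* The explicit inverse of the matrix of the two columns. *)
suff <- : block_mx t%:M t%:M 1%:M (- 1%:M) *m
   block_mx (t^-1 * Fhalf)%:M Fhalf%:M (t^-1 * Fhalf)%:M (- Fhalf%:M) = 1%:M
   :> 'M[K]_(n + n).
  by rewrite mulmxA ZZ mul0mx.
rewrite mulmx_block scalar_mx_block.
rewrite !mul1mx !mulNmx !mulmxN !mul1mx -!scalar_mxM opprK !mulrA mulfV // mul1r subrr.
by rewrite subrr -!raddfD /= Fhalf_double.
Qed.

(** On the column (1, 1), [Xd 1] acts as P + Q = A, and [Yd (-1)] as the adjoint of P - Q, which is
    [C]. *)
Lemma mxeval_Xd_Yd p :
  mxeval (Xd 1) (Yd (- 1)) p *m col_mx 1%:M 1%:M = col_mx 1%:M 1%:M *m mxeval A C p.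
Proof.
apply: mxeval_intertwine => j; rewrite mul_block_col mul_col_mx mul1mx !mulmx1.
  by rewrite invr1 !scale1r [Qm j + _]addrC PmDQm.
by rewrite invrN invr1 !scaleN1r [- _ + _]addrC -daggerN -daggerD PmBQm daggerK.
Qed.

(** Conjugation by diag(t, 1). That t is real makes the adjoint of t Q carry the same factor t. *)
Lemma mxeval_Xd_conj (x : R) p : x <> R0 ->
  mxeval (Xd (ofR k x)) (fun j => dagger (Xd (ofR k x) j)) p = 0 ->
  mxeval (Xd 1) (Yd (ofR k x * ofR k x)) p = 0.
Proof.
move=> x0 p0; have t0 := @ofR_neq0 k _ x0; set t := ofR k x in p0 t0 *.
have := @mxeval_intertwine k g _ _ (Xd t) (fun j => dagger (Xd t j))
  (Xd 1) (Yd (t * t)) (block_mx t%:M 0 0 1%:M) p.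
rewrite p0 mul0mx => H.
have {}H : block_mx t%:M 0 0 1%:M *m mxeval (Xd 1) (Yd (t * t)) p = 0.
  symmetry; apply: H => j.
    rewrite !mulmx_block !(mulmx0, mul0mx, mulmx1, mul1mx, addr0, add0r).
    by rewrite !mul_scalar_mx !mul_mx_scalar !scalerA mulfV // invr1 mulr1.
  rewrite dagger_Xd // -/t !mulmx_block.
  rewrite !(mulmx0, mul0mx, mulmx1, mul1mx, addr0, add0r).
  by rewrite !mul_scalar_mx !mul_mx_scalar !scalerA invfM mulrA mulfV // mul1r.
rewrite -[LHS]mul1mx.
suff <- : block_mx (t^-1)%:M 0 0 1%:M *m block_mx t%:M 0 0 1%:M = 1%:M :> 'M[K]_(n + n).
  by rewrite -mulmxA H mulmx0.
rewrite mulmx_block !(mulmx0, mul0mx, mulmx1, mul1mx, addr0, add0r).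
by rewrite -scalar_mxM mulVf // -scalar_mx_block.
Qed.

End Doubling.

(** * A bounded sequence of matrix points separating low degrees *)

Lemma finite_upper_bound (T : finType) (f : T -> R) : exists c, forall x, (f x <= c)%Re.
Proof.
suff [c fc] : exists c, forall x, x \in enum T -> (f x <= c)%Re.
  by exists c => x; apply: fc; rewrite mem_enum.
elim: (enum T) => [|y s [c IH]]; first by exists R0.
exists (Rmax (f y) c) => x; rewrite inE => /predU1P[->|/IH xc]; first exact: Rmax_l.
exact: Rle_trans xc (Rmax_r _ _).
Qed.

Section SeparatingFamily.
Variables (k : fkind) (g : nat).
Local Notation K := (scal k).

Lemma XdE n (A C : 'I_g -> 'M[K]_n) t j :
  Xd A C t j = block_mx (Pm A C j) 0 0 (Pm A C j) + t *: block_mx 0 (Qm A C j) 0 0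
               + t^-1 *: block_mx 0 0 (Qm A C j) 0.
Proof.
by rewrite !scale_block_mx !add_block_mx !(scaler0, addr0, add0r).
Qed.

Lemma YdE n (A C : 'I_g -> 'M[K]_n) s j :
  Yd A C s j = block_mx (dagger (Pm A C j)) 0 0 (dagger (Pm A C j))
               + s *: block_mx 0 0 (dagger (Qm A C j)) 0
               + s^-1 *: block_mx 0 (dagger (Qm A C j)) 0 0.
Proof.
by rewrite !scale_block_mx !add_block_mx !(scaler0, addr0, add0r).
Qed.

(** Infinitely many parameters with distinct squares, bounded and bounded away from 0, so that both
    t and 1/t stay bounded in [Xd]. *)
Definition node (m : nat) : R := (1 + / (INR m + 1))%Re.

Lemma node_bounds m : (1 < node m <= 2)%Re.
Proof.
have m1 : (1 <= INR m + 1)%Re by have := pos_INR m; lra.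
have h1 : (0 < / (INR m + 1))%Re by apply: Rinv_0_lt_compat; lra.
have h2 : (/ (INR m + 1) <= 1)%Re by rewrite -Rinv_1; apply: Rinv_le_contravar; lra.
by rewrite /node; lra.
Qed.

Lemma node_sqr_inj : injective (fun m => node m * node m)%Re.
Proof.
move=> m m'; have := node_bounds m; have := node_bounds m' => b b' e.
have {}e : node m = node m' by nra.
have {}e : (/ (INR m + 1) = / (INR m' + 1))%Re by move: e; rewrite /node; lra.
apply: INR_eq; have := Rinv_eq_reg _ _ e; lra.
Qed.

Lemma Xd_entry_bound n (A C : 'I_g -> 'M[K]_n) :
  exists c, forall m j a b, (Fnsq (Xd A C (ofR k (node m)) j a b) <= c)%Re.
Proof.
pose T := ('I_g * 'I_(n + n) * 'I_(n + n))%type.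
pose Z1 j : 'M[K]_(n + n) := block_mx (Pm A C j) 0 0 (Pm A C j).
pose Z2 j : 'M[K]_(n + n) := block_mx 0 (Qm A C j) 0 0.
pose Z3 j : 'M[K]_(n + n) := block_mx 0 0 (Qm A C j) 0.
have bnd (Z : 'I_g -> 'M[K]_(n + n)) : exists c, forall j a b, (Fnsq (Z j a b) <= c)%Re.
  have [c cP] := finite_upper_bound (fun x : T => Fnsq (Z x.1.1 x.1.2 x.2)).
  by exists c => j a b; apply: (cP (j, a, b)).
have [[c1 h1] [c2 h2] [c3 h3]] := And3 (bnd Z1) (bnd Z2) (bnd Z3).
(* [FnsqD_le] is applied twice; the 4 bounds t^2 for t <= 2, while 1/t contributes at most 1. *)
exists (2 * (2 * c1 + 2 * (4 * c2)) + 2 * c3)%Re => m j a b.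
have [n1 n2] := node_bounds m; set x := node m in n1 n2 *.
have -> : Xd A C (ofR k x) j a b = Z1 j a b + ofR k x * Z2 j a b + (ofR k x)^-1 * Z3 j a b.
  by rewrite XdE -/(Z1 j) -/(Z2 j) -/(Z3 j) 2!mxE; congr (_ + _ + _); rewrite mxE.
have := h1 j a b; have := h2 j a b; have := h3 j a b.
set z1 := Z1 j a b; set z2 := Z2 j a b; set z3 := Z3 j a b => b3 b2 b1.
apply: Rle_trans (FnsqD_le _ _) _; have := FnsqD_le z1 (ofR k x * z2).
have x0 : x <> R0 by lra.
rewrite -ofRV // !FnsqM !Fnsq_ofR.
have i1 : (0 < / x <= 1)%Re.
  split; first by apply: Rinv_0_lt_compat; lra.
  by rewrite -Rinv_1; apply: Rinv_le_contravar; lra.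
have := Fnsq_ge0 z2; have := Fnsq_ge0 z3 => p3 p2.
have : (x * x * Fnsq z2 <= 4 * Fnsq z2)%Re by apply: Rmult_le_compat_r => //; nra.
have : (/ x * / x * Fnsq z3 <= 1 * Fnsq z3)%Re by apply: Rmult_le_compat_r => //; nra.
lra.
Qed.

Variable S : ncpoly k g -> Prop.
Hypothesis S_hom : forall q, S q -> homogeneous q.
Hypothesis S_an : forall q, S q -> analytic q.

Definition starval n (X : 'I_g -> 'M[K]_n) p := mxeval X (fun j => dagger (X j)) p.

Lemma starval_pstar n (X : 'I_g -> 'M[K]_n) p : starval X (pstar p) = dagger (starval X p).
Proof. 
rewrite /starval mxeval_star; congr (mxeval _ _ _).
by apply/funext => j; rewrite daggerK.
 Qed.

(** The points are [Xd] at the nodes. If p vanishes at all of them, the Laurent functions given by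
    the entries of p(X_1,Y_s) vanish at infinitely many s, hence at s = -1, where they determine
    p(A,C). *)
Lemma separating_family N :
  exists n (X : nat -> 'I_g -> 'M[K]_n),
   [/\ forall m q, in_star_ideal S q -> starval (X m) q = 0,
       forall p, (forall w, coef p w <> 0 -> (size w <= N)%N) ->
         (forall m, starval (X m) p = 0) -> in_star_ideal S p
     & exists c, forall m j a b, (Fnsq (X m j a b) <= c)%Re].
Proof.
have [n [A [C [AC0 ACN]]]] := finite_quotient S_hom N.
have node0 m : node m <> R0 by have := node_bounds m; lra.
exists (n + n)%N, (fun m => Xd A C (ofR k (node m))); split; last exact: Xd_entry_bound.
  move=> m.
  have S0 s : S s -> starval (Xd A C (ofR k (node m))) s = 0.
    move=> sS; apply: mxeval_Xd_analytic; rewrite ?ofR_neq0 //; first exact: S_an.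
      by apply/AC0/(ideal_sub false).
    by apply/AC0/(ideal_sub true).
  apply: mxeval_ideal => s sS; first exact: S0.
  by rewrite -/(starval _ _) starval_pstar S0 // dagger0.
move=> p pN p0; apply: ACN => //; apply/matrixP => a b; rewrite [RHS]mxE.
apply: contrapT => nz.
(* At s = -1 this is the (a, b) entry of p(A,C), assumed nonzero. *)
pose f s := (mxeval (Xd A C 1) (Yd A C s) p *m col_mx 1%:M 1%:M) (lshift n a) b.
have lf : laurent f.
  rewrite /f; under eq_fun do rewrite mxE; apply: laurent_sum => i.
  apply: laurentM; last exact: laurent_cst.
  apply: laurent_mxeval => j a' b'; first exact: laurent_cst.
  under eq_fun do rewrite YdE !mxE.
  apply: laurentD; [apply: laurentD; first exact: laurent_cst|];
  by apply: laurentM; [apply: laurent_id || apply: laurent_inv | apply: laurent_cst].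
have [||||m] := laurent_neq0 (z := -1) (x := fun m => ofR k (node m) * ofR k (node m)) lf.
- by rewrite oppr_eq0 oner_eq0.
- by rewrite /f mxeval_Xd_Yd mul_col_mx col_mxEu mul1mx; apply/eqP.
- by move=> m m'; rewrite -!ofRM => /ofR_inj /node_sqr_inj.
- by move=> m; rewrite mulf_neq0 // ofR_neq0.
by rewrite /f mxeval_Xd_conj //= ?mul0mx ?mxE ?eqxx //; apply: p0.
Qed.

End SeparatingFamily.

(** * Series of nonnegative reals *)

Section RealSeries.
Implicit Types (a b : nat -> R) (E : R).

Lemma sum_n_nondecr a : (forall i, (0 <= a i)%Re) ->
  forall i, (sum_n a i <= sum_n a i.+1)%Re.
Proof.
move=> a0 i; rewrite sum_Sn; change (sum_n a i <= sum_n a i + a i.+1)%Re.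
by have := a0 i.+1; lra.
Qed.

Lemma sum_n_le_Series a : (forall i, (0 <= a i)%Re) -> ex_series a ->
  forall i, (sum_n a i <= Series a)%Re.
Proof.
move=> a0 /Series_correct sa; apply: is_lim_seq_incr_compare; first exact: sa.
exact: sum_n_nondecr.
Qed.

Lemma term_le_Series a : (forall i, (0 <= a i)%Re) -> ex_series a ->
  forall i, (a i <= Series a)%Re.
Proof.
move=> a0 sa i; apply: Rle_trans (sum_n_le_Series a0 sa i).
case: i => [|i]; first by rewrite sum_O; apply: Rle_refl.
rewrite sum_Sn; change (a i.+1 <= sum_n a i + a i.+1)%Re.
suff : (0 <= sum_n a i)%Re by lra.
elim: i => [|i IH]; first by rewrite sum_O.
exact: Rle_trans IH (sum_n_nondecr a0 i).
Qed.

Lemma bounded_series a E : (forall i, (0 <= a i)%Re) ->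
  (forall i, (sum_n a i <= E)%Re) -> ex_series a /\ (Series a <= E)%Re.
Proof.
move=> a0 aE.
have [l sl] : ex_finite_lim_seq (sum_n a).
  by apply: (ex_finite_lim_seq_incr _ E) => // i; apply: sum_n_nondecr.
have sal : is_series a l by exact: sl.
split; first by exists l.
rewrite (is_series_unique _ _ sal).
exact: (is_lim_seq_le _ _ (Rbar.Finite l) (Rbar.Finite E) aE sl (is_lim_seq_const E)).
Qed.

Lemma ex_series_dom a b : (forall i, (Rabs (a i) <= b i)%Re) -> ex_series b -> ex_series a.
Proof. by move=> ab sb; apply: ex_series_le sb => i; exact: ab. Qed.

Lemma Series_zero : Series (fun _ => R0) = R0.
Proof.
apply: is_series_unique.
suff : is_lim_seq (sum_n (fun _ => R0)) R0 by [].
apply: (is_lim_seq_ext (fun _ => R0)); last exact: is_lim_seq_const.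
elim=> [|i IH]; first by rewrite sum_O.
by rewrite sum_Sn -IH; change (R0 = R0 + R0)%Re; lra.
Qed.

Lemma Series_eq0 a : (forall i, (0 <= a i)%Re) -> ex_series a -> Series a = R0 ->
  forall i, a i = R0.
Proof. by move=> a0 sa s0 i; have := term_le_Series a0 sa i; have := a0 i; lra. Qed.

End RealSeries.

(** * Inner product and squared norm of columns *)

Section ColumnNorm.
Variable k : fkind.
Local Notation K := (scal k).

Definition binner n (u v : 'cV[K]_n) : K := (dagger v *m u) 0 0.
(** The squared norm; the triangle inequality is replaced by [bnormD_le], with factors 2. *)
Definition bnorm n (u : 'cV[K]_n) : R := Fre (binner u u).

Lemma binnerE n (u v : 'cV[K]_n) : binner u v = \sum_a u a 0 * Fconj (v a 0).
Proof. by rewrite /binner mxE; apply: eq_bigr => a _; rewrite !mxE mulrC. Qed.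

Lemma binnerDl n (u v w : 'cV[K]_n) : binner (u + v) w = binner u w + binner v w.
Proof. by rewrite /binner mulmxDr mxE. Qed.

Lemma binnerZl n c (u w : 'cV[K]_n) : binner (c *: u) w = c * binner u w.
Proof. by rewrite /binner -scalemxAr mxE. Qed.

Lemma binnerC n (u v : 'cV[K]_n) : binner v u = Fconj (binner u v).
Proof.
rewrite !binnerE rmorph_sum; apply: eq_bigr => a _.
by rewrite rmorphM /= FconjK mulrC.
Qed.

Lemma binner_adjoint n (X : 'M[K]_n) (u v : 'cV[K]_n) :
  binner (X *m u) v = binner u (dagger X *m v).
Proof. by rewrite /binner daggerM daggerK mulmxA. Qed.

Lemma Fre_sum_ge0 (I : Type) (r : seq I) (P : pred I) (F : I -> K) :
  (forall i, (0 <= Fre (F i))%Re) -> (0 <= Fre (\sum_(i <- r | P i) F i)%R)%Re.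
Proof.
move=> F0; apply: (big_ind (fun z => 0 <= Fre z)%Re) => // [|x y x0 y0].
  by rewrite FrE; lra.
by rewrite FrE; lra.
Qed.

Lemma bnorm_term n (u : 'cV[K]_n) a : (Fnsq (u a 0%R) <= bnorm u)%Re.
Proof.
rewrite /bnorm binnerE (bigD1 a) //= FreD Fre_mulconj -[X in (X <= _)%Re]Rplus_0_r.
apply: Rplus_le_compat_l; apply: Fre_sum_ge0 => i.
by rewrite Fre_mulconj; apply: Fnsq_ge0.
Qed.

Lemma bnorm_ge0 n (u : 'cV[K]_n) : (0 <= bnorm u)%Re.
Proof.
rewrite /bnorm binnerE; apply: Fre_sum_ge0 => a.
by rewrite Fre_mulconj; apply: Fnsq_ge0.
Qed.

Lemma bnorm_eq0 n (u : 'cV[K]_n) : bnorm u = R0 -> u = 0.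
Proof.
move=> u0; apply/colP => a; rewrite mxE; apply: Fnsq_eq0.
by have := bnorm_term u a; have := Fnsq_ge0 (u a 0); lra.
Qed.

(** A termwise substitute for Cauchy-Schwarz, strong enough for convergence of the inner product
    series. *)
Lemma binner_abs_le n (u v : 'cV[K]_n) :
  (Rabs (Fre (binner u v)) <= bnorm u + bnorm v)%Re /\
  (Rabs (Fim (binner u v)) <= bnorm u + bnorm v)%Re.
Proof.
rewrite /bnorm !binnerE.
apply: (big_rec3 (fun x y z : K =>
  (Rabs (Fre x) <= Fre y + Fre z)%Re /\ (Rabs (Fim x) <= Fre y + Fre z)%Re)).
  by rewrite !FrE Rabs_R0; lra.
move=> a x y z _ [h1 h2]; rewrite !FreD FimD !Fre_mulconj.
set c := u a 0; set d := v a 0.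
have [e1 e2] : (Rabs (Fre (c * Fconj d)%R) <= Fnsq c + Fnsq d)%Re /\
               (Rabs (Fim (c * Fconj d)%R) <= Fnsq c + Fnsq d)%Re.
  rewrite !FrE /Fnsq; move: (Fre c) (Fim c) (Fre d) (Fim d) => c1 c2 d1 d2.
  have := (Rle_0_sqr (c1 - d1), Rle_0_sqr (c1 + d1), Rle_0_sqr (c2 - d2), Rle_0_sqr (c2 + d2)).
  have := (Rle_0_sqr (c1 - d2), Rle_0_sqr (c1 + d2), Rle_0_sqr (c2 - d1), Rle_0_sqr (c2 + d1)).
  rewrite /Rsqr => -[[[? ?] ?] ?] [[[? ?] ?] ?].
  have := (Rle_0_sqr c1, Rle_0_sqr c2, Rle_0_sqr d1, Rle_0_sqr d2).
  by rewrite /Rsqr => -[[[? ?] ?] ?]; split; apply: Rabs_le; lra.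
split; [have := Rabs_triang (Fre (c * Fconj d)) (Fre x)
       |have := Rabs_triang (Fim (c * Fconj d)) (Fim x)]; lra.
Qed.

Lemma bnormD_le n (u v : 'cV[K]_n) : (bnorm (u + v)%R <= 2 * bnorm u + 2 * bnorm v)%Re.
Proof.
rewrite /bnorm !binnerE.
apply: (big_rec3 (fun x y z : K => (Fre x <= 2 * Fre y + 2 * Fre z)%Re)).
  by rewrite !FrE; lra.
move=> a x y z _ h; rewrite !FreD !Fre_mulconj.
have comb r r1 r2 s s1 s2 : (r <= 2 * r1 + 2 * r2 -> s <= 2 * s1 + 2 * s2 ->
  r + s <= 2 * (r1 + s1) + 2 * (r2 + s2))%Re by lra.
by apply: comb => //; rewrite mxE; apply: FnsqD_le.
Qed.

Lemma bnormZ n c (u : 'cV[K]_n) : bnorm (c *: u) = (Fnsq c * bnorm u)%Re.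
Proof.
rewrite /bnorm binnerZl binnerC binnerZl rmorphM /= -binnerC mulrA FreM.
rewrite Fre_mulconj FimM Fre_conj Fim_conj; lra.
Qed.

Lemma bnorm0 n : bnorm (0 : 'cV[K]_n) = R0.
Proof. by rewrite -(scale0r (0 : 'cV[K]_n)) bnormZ /Fnsq !FrE; lra. Qed.

Lemma Fnsq_sum_le (I : Type) (r : seq I) (z : I -> K) E : (0 <= E)%Re ->
  (forall i, (Fnsq (z i) <= E)%Re) ->
  (Fnsq (\sum_(i <- r) z i)%R <= 4 ^ size r * E)%Re.
Proof.
move=> E0 zE; elim: r => [|i r IH]; first by rewrite big_nil /Fnsq !FrE /=; lra.
rewrite big_cons; apply: Rle_trans (FnsqD_le _ _) _ => /=.
have p1 : (1 <= 4 ^ size r)%Re by apply: pow_R1_Rle; lra.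
have pE : (E <= 4 ^ size r * E)%Re by nra.
have comb r1 r2 p : (r1 <= E -> r2 <= p * E -> E <= p * E ->
  2 * r1 + 2 * r2 <= 4 * p * E)%Re by lra.
exact: comb.
Qed.

Lemma Fre_sum_le (I : Type) (r : seq I) (z : I -> K) E :
  (forall i, (Fre (z i) <= E)%Re) -> (Fre (\sum_(i <- r) z i)%R <= INR (size r) * E)%Re.
Proof.
move=> zE; elim: r => [|i r IH]; first by rewrite big_nil /= FrE; lra.
rewrite big_cons FreD [size _]/= S_INR Rmult_plus_distr_r Rmult_1_l Rplus_comm.
exact: Rplus_le_compat.
Qed.

(** The bound is crude, but [M] depends only on [n] and [c], so one rescaling handles a whole
    sequence of matrices. *)
Lemma mulmx_bound n (c : R) : exists2 M : R, (0 < M)%Re & forall X : 'M[K]_n,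
  (forall a b, (Fnsq (X a b) <= c)%Re) ->
  forall u : 'cV_n, (bnorm (X *m u) <= M * bnorm u)%Re.
Proof.
pose e := index_enum 'I_n.
(* The final 1 keeps the bound positive, so that its square root can be inverted. *)
exists (INR (size e) * (4 ^ size e * Rabs c) + 1)%Re.
  have := pos_INR (size e); have := Rabs_pos c.
  have : (0 < 4 ^ size e)%Re by apply: pow_lt; lra.
  move=> p1 p2 p3; have := Rmult_le_pos _ _ (Rlt_le _ _ p1) p2 => p4.
  by have := Rmult_le_pos _ _ p3 p4; lra.
move=> X Xc u; have u0 := bnorm_ge0 u.
suff : (bnorm (X *m u)%R <= INR (size e) * (4 ^ size e * (Rabs c * bnorm u)))%Re by lra.
rewrite {1}/bnorm binnerE; apply: Fre_sum_le => a; rewrite Fre_mulconj mxE.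
apply: Fnsq_sum_le => [|b]; first by apply: Rmult_le_pos => //; apply: Rabs_pos.
rewrite FnsqM; apply: Rmult_le_compat; try exact: Fnsq_ge0.
  exact: Rle_trans (Xc a b) (Rle_abs c).
exact: bnorm_term.
Qed.

End ColumnNorm.

(** * A countable separating family of contractions *)

Section CountableFamily.
Variables (k : fkind) (g : nat) (S : ncpoly k g -> Prop).
Hypothesis S_hom : forall q, S q -> homogeneous q.
Hypothesis S_an : forall q, S q -> analytic q.
Local Notation K := (scal k).

Lemma ideal_dilate (c : K) p : c != 0 ->
  in_star_ideal S (degscale (fun d => c ^+ d) p) <-> in_star_ideal S p.
Proof.
move=> c0; split=> mp; last exact: ideal_degscale.
apply: ideal_peq (ideal_degscale S_hom (fun d => c ^- d) mp) => w.
by rewrite !coef_degscale mulrA mulVf ?mul1r // expf_neq0.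
Qed.

Lemma starval_dilate n (X : 'I_g -> 'M[K]_n) (x : R) p :
  starval (fun j => ofR k x *: X j) p = starval X (degscale (fun d => ofR k x ^+ d) p).
Proof.
rewrite /starval -mxeval_dilate; congr (mxeval _ _ _).
by apply/funext => j; rewrite daggerZ Fconj_ofR.
Qed.

(** A real dilation scales adjoints by the same factor and, by gradedness, preserves membership in
    the ideal. Packing size and tuples in a sigma type lets [choice] select one family for every
    [N]. *)
Lemma contractive_family N :
  exists F : {n & nat -> 'I_g -> 'M[K]_n}, let X := projT2 F in
   [/\ forall m q, in_star_ideal S q -> starval (X m) q = 0,
       forall p, (forall w, coef p w <> 0 -> (size w <= N)%N) ->
         (forall m, starval (X m) p = 0) -> in_star_ideal S p
     & forall m j u, (bnorm (X m j *m u) <= bnorm u)%Re /\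
                     (bnorm (dagger (X m j) *m u) <= bnorm u)%Re].
Proof.
have [n [X [X0 XN [c Xc]]]] := separating_family S_hom S_an N.
have [M M0 MX] := mulmx_bound k n c.
(* The square root appears because [M] bounds squared norms. *)
pose x := (/ sqrt M)%Re.
have sM : (0 < sqrt M)%Re by apply: sqrt_lt_R0.
have x0 : x <> R0 by apply: Rinv_neq_0_compat; lra.
have xx : (x * x * M = 1)%Re.
  by rewrite /x -{3}(sqrt_sqrt M); [field; lra | lra].
have bnd (Z : 'M[K]_n) u : (forall a b, (Fnsq (Z a b) <= c)%Re) ->
    (bnorm (ofR k x *: (Z *m u)) <= bnorm u)%Re.
  move=> Zc; rewrite bnormZ Fnsq_ofR; apply: (Rle_trans _ (x * x * (M * bnorm u))).
    by apply: Rmult_le_compat_l (MX Z Zc u); nra.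
  by rewrite -Rmult_assoc xx Rmult_1_l; apply: Rle_refl.
exists (existT _ n (fun m j => ofR k x *: X m j)); split=> /=.
- by move=> m q mq; rewrite starval_dilate X0 //; apply: ideal_degscale.
- move=> p pN p0; apply/(ideal_dilate _ (ofR_neq0 k x0))/XN => [w|m].
    rewrite coef_degscale => nz; apply: pN => z.
    by apply: nz; rewrite z mulr0.
  by rewrite -starval_dilate.
move=> m j u; rewrite daggerZ Fconj_ofR -!scalemxAl; split; apply: bnd => a b //.
by rewrite !mxE /Fnsq Fre_conj Fim_conj Rmult_opp_opp; apply: Xc.
Qed.

Lemma countable_family :
  exists (n : nat -> nat) (X : forall i, 'I_g -> 'M[K]_(n i)),
   [/\ forall i q, in_star_ideal S q -> starval (X i) q = 0,
       forall p, (forall i, starval (X i) p = 0) -> in_star_ideal S p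
     & forall i j u, (bnorm (X i j *m u) <= bnorm u)%Re /\
                     (bnorm (dagger (X i j) *m u) <= bnorm u)%Re].
Proof.
have [F FP] := choice contractive_family.
(* Each i encodes a pair (N, m); an i that encodes none merely repeats the member (0, 0). *)
pose dec i : nat * nat := odflt (0, 0)%N (unpickle i).
exists (fun i => projT1 (F (dec i).1)), (fun i => projT2 (F (dec i).1) (dec i).2); split.
- by move=> i q; case: (FP (dec i).1) => F0 _ _; apply: F0.
(* The separating property for p is needed only at a single degree bound covering its words. *)
- move=> p p0; pose N := \max_(t <- p) size t.2.
  case: (FP N) => _ FN _; apply: FN => [w|m].
    rewrite coefE => nz; rewrite leqNgt; apply/negP => Nw; apply: nz.
    rewrite big_seq big1 // => t tp; case: eqP => // tw; move: Nw.
    by rewrite -tw ltnNge /N (@leq_bigmax_seq _ p xpredT (fun t => size t.2) t tp).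
  have := p0 (pickle (N, m)).
  by rewrite /dec pickleK.
- by move=> i j u; case: (FP (dec i).1) => _ _; apply.
Qed.

Lemma foldr_Fadd (I : Type) (r : seq I) (F : I -> K) :
  foldr (fun l acc => Fadd (F l) acc) (F0 k) r = \sum_(l <- r) F l.
Proof. by elim: r => [|l r IH]; rewrite ?big_nil // big_cons /= IH. Qed.

Lemma mat_evalE n (X : 'I_g -> mat k) p (a b : 'I_n) :
  mat_eval n X p a b = starval (fun j => \matrix_(i, l) X j i l : 'M[K]_n) p a b.
Proof.
rewrite /starval /mxeval /linext summxE /mat_eval /eval_poly.
elim: p => [|t p IH]; first by rewrite big_nil.
rewrite big_cons -IH /= mxE; apply: (congr2 (@Fadd k)) => //; apply: (congr2 (@Fmul k)) => //.
elim: t.2 a b {IH} => [|[j e] w IH] a b; first by rewrite /wordmx /= mxE -val_eqE /=; case: eqP.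
rewrite wordmx_cons mxE.
transitivity (\sum_(0 <= l < n) Fmul (if e then Fconj (X j l a) else X j a l)
   (eval_word k (fun i j => if i == j then F1 k else F0 k)
    (fun A B i j => foldr (fun l acc => Fadd (Fmul (A i l) (B l j)) acc) (F0 k) (iota 0 n))
    X (fun m i j => Fconj (X m j i)) w l b)).
  rewrite /index_iota subn0 [LHS]foldr_Fadd; apply: eq_bigr => l _ /=.
  by case: e.
rewrite big_mkord; apply: eq_bigr => l _; rewrite IH; congr (_ * _).
by rewrite /letmx /=; case: e; rewrite !mxE.
Qed.

Definition tomat n (M : 'M[K]_n) : mat k := fun a b =>
  if insub a is Some i then if insub b is Some j then M i j else 0 else 0.

Lemma tomatK n (M : 'M[K]_n) : \matrix_(i, j) tomat M i j = M.
Proof. by apply/matrixP => i j; rewrite mxE /tomat !valK. Qed.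

End CountableFamily.

(** * Limits of scalar sequences *)

Section ScalarLimits.
Variable k : fkind.
Local Notation K := (scal k).
Implicit Types (z y : nat -> K) (l : K).

Definition is_flim z l :=
  is_lim_seq (fun m => Fre (z m)) (Fre l) /\ is_lim_seq (fun m => Fim (z m)) (Fim l).

Lemma flim_cst l : is_flim (fun _ => l) l.
Proof. by split; apply: is_lim_seq_const. Qed.

Lemma flimD z y l l' : is_flim z l -> is_flim y l' -> is_flim (fun m => z m + y m) (l + l').
Proof.
move=> [zr zi] [yr yi]; split; rewrite !FrE.
  by apply: is_lim_seq_ext (is_lim_seq_plus' _ _ _ _ zr yr) => m; rewrite FreD.
by apply: is_lim_seq_ext (is_lim_seq_plus' _ _ _ _ zi yi) => m; rewrite FimD.
Qed.

Lemma flim_sum (I : Type) (r : seq I) (z : I -> nat -> K) (l : I -> K) :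
  (forall i, is_flim (z i) (l i)) ->
  is_flim (fun m => \sum_(i <- r) z i m) (\sum_(i <- r) l i).
Proof.
move=> zl; elim: r => [|i r IH].
  by under eq_fun do rewrite big_nil; rewrite big_nil; apply: flim_cst.
by under eq_fun do rewrite big_cons; rewrite big_cons; apply: flimD.
Qed.

Lemma flim_mulconj z l : is_flim z l -> is_flim (fun m => z m * Fconj (z m)) (l * Fconj l).
Proof.
move=> [zr zi].
have zni : is_lim_seq (fun m => - Fim (z m))%Re (- Fim l)%Re by apply/(is_lim_seq_opp _ (Fim l)).
split; rewrite !FrE.
  apply: is_lim_seq_ext (is_lim_seq_minus' _ _ _ _ (is_lim_seq_mult' _ _ _ _ zr zr)
    (is_lim_seq_mult' _ _ _ _ zi zni)) => m; by rewrite !FrE.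
apply: is_lim_seq_ext (is_lim_seq_plus' _ _ _ _ (is_lim_seq_mult' _ _ _ _ zr zni)
    (is_lim_seq_mult' _ _ _ _ zi zr)) => m; by rewrite !FrE.
Qed.

Lemma flim_cauchy z :
  (forall e, (0 < e)%Re -> exists N : nat, forall m n : nat, (N <= m)%N -> (N <= n)%N ->
     (Fnsq (z m - z n)%R < e * e)%Re) ->
  exists l, is_flim z l.
Proof.
move=> zc.
have part (f : K -> R) : (forall a b, (Rabs (f a - f b) * Rabs (f a - f b) <= Fnsq (a - b)%R)%Re) ->
    ex_finite_lim_seq (fun m => f (z m)).
  move=> fle; apply/ex_lim_seq_cauchy_corr => -[e e0] /=.
  have [N NP] := zc e e0; exists N => m n /leP Nm /leP Nn.
  have := NP m n Nm Nn; have := fle (z m) (z n); have := Rabs_pos (f (z m) - f (z n)); nra.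
have Rabs2 x : (Rabs x * Rabs x = x * x)%Re by rewrite -Rabs_mult Rabs_pos_eq //; nra.
have [|lr zr] := part (@Fre k).
  by move=> a b; rewrite Rabs2 /Fnsq !FrE; have := Rle_0_sqr (Fim a - Fim b); rewrite /Rsqr; lra.
have [|li zi] := part (@Fim k).
  by move=> a b; rewrite Rabs2 /Fnsq !FrE; have := Rle_0_sqr (Fre a - Fre b); rewrite /Rsqr; lra.
(* Over the reals [Fmk] forgets [li], so it remains to see that this limit of zeros is 0. *)
exists (Fmk k lr li); split; rewrite ?Fre_mk // Fim_mk // => kR.
have := is_lim_seq_unique _ _ zi; rewrite (Lim_seq_ext _ (fun _ => R0)) => [|m].
  by rewrite Lim_seq_const => -[].
exact: Fim_real.
Qed.

End ScalarLimits.

(** * The l2 direct sum as a Hilbert space *)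

Lemma sqrt_lt_sqr (x e : R) : (0 <= x -> sqrt x < e -> x < e * e)%Re.
Proof. by move=> x0 lt; have := sqrt_sqrt _ x0; have := sqrt_pos x; nra. Qed.

Section DirectSum.
Variables (k : fkind) (n : nat -> nat).
Local Notation K := (scal k).
Local Notation seqs := (forall i, 'cV[K]_(n i)).
Implicit Types (f h : seqs).

Definition square_summable f := ex_series (fun i => bnorm (f i)).

Definition l2sum := {f : seqs | square_summable f}.

Lemma l2_ext (u v : l2sum) : (forall i, sval u i = sval v i) -> u = v.
Proof.
case: u v => [f pf] [h ph] /= fh; have {}fh : f = h by apply: functional_extensionality_dep.
by subst h; congr exist; apply: Prop_irrelevance.
Qed.

Lemma summable_dom f h (c : R) : (forall i, (bnorm (f i) <= c * bnorm (h i))%Re) ->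
  square_summable h -> square_summable f.
Proof.
move=> fh sh; apply: (@ex_series_dom _ (fun i => c * bnorm (h i))%Re) => [i|].
  by rewrite Rabs_pos_eq //; apply: bnorm_ge0.
exact: ex_series_scal_l.
Qed.

Lemma summableD f h : square_summable f -> square_summable h ->
  square_summable (fun i => f i + h i).
Proof.
move=> sf sh.
apply: (@ex_series_dom _ (fun i => 2 * bnorm (f i) + 2 * bnorm (h i))%Re) => [i|].
  rewrite Rabs_pos_eq; [exact: bnormD_le | exact: bnorm_ge0].
by apply: ex_series_plus; apply: ex_series_scal_l.
Qed.

Lemma summableZ c f : square_summable f -> square_summable (fun i => c *: f i).
Proof. by apply: summable_dom (Fnsq c) _ => i; rewrite bnormZ; apply: Rle_refl. Qed.

Lemma summable0 : square_summable (fun i => 0).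
Proof.
have [] := @bounded_series (fun i => bnorm (0 : 'cV[K]_(n i))) R0 => // [i|i].
  exact: bnorm_ge0.
elim: i => [|i IH]; first by rewrite sum_O bnorm0; apply: Rle_refl.
by rewrite sum_Sn bnorm0 plus_zero_r.
Qed.

Definition l2zero : l2sum := exist _ _ summable0.
Definition l2add (u v : l2sum) : l2sum := exist _ _ (summableD (svalP u) (svalP v)).
Definition l2scale c (u : l2sum) : l2sum := exist _ _ (summableZ c (svalP u)).
Definition l2opp (u : l2sum) : l2sum := l2scale (- 1) u.

Definition Fseries (z : nat -> K) : K :=
  Fmk k (Series (fun i => Fre (z i))) (Series (fun i => Fim (z i))).

Lemma Fre_series z : Fre (Fseries z) = Series (fun i => Fre (z i)).
Proof. exact: Fre_mk. Qed.

Lemma Fim_series z : Fim (Fseries z) = Series (fun i => Fim (z i)).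
Proof.
apply: Fim_mk => kR; rewrite -Series_zero; apply: Series_ext => i; exact: Fim_real.
Qed.

Definition l2inner (u v : l2sum) : K := Fseries (fun i => binner (sval u i) (sval v i)).

Lemma ex_series_binner (u v : l2sum) :
  ex_series (fun i => Fre (binner (sval u i) (sval v i))) /\
  ex_series (fun i => Fim (binner (sval u i) (sval v i))).
Proof.
have s : ex_series (fun i => bnorm (sval u i) + bnorm (sval v i))%Re.
  exact: ex_series_plus (svalP u) (svalP v).
by split; apply: ex_series_dom s => i; have [] := binner_abs_le (sval u i) (sval v i).
Qed.

Lemma l2innerDl u v w : l2inner (l2add u v) w = Fadd (l2inner u w) (l2inner v w).
Proof.
have [ur ui] := ex_series_binner u w; have [vr vi] := ex_series_binner v w.
apply: scal_ext; rewrite ?(Fre_add, Fim_add) ?Fre_series ?Fim_series -Series_plus //;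
by apply: Series_ext => i; rewrite /= binnerDl ?FreD ?FimD.
Qed.

Lemma l2innerZl a u w : l2inner (l2scale a u) w = Fmul a (l2inner u w).
Proof.
have [ur ui] := ex_series_binner u w.
have ex c s : ex_series s -> ex_series (fun i => c * s i)%Re by apply: ex_series_scal_l.
apply: scal_ext; rewrite ?(Fre_mul, Fim_mul) ?Fre_series ?Fim_series -!Series_scal_l.
  rewrite -Series_minus; try exact: ex.
  by apply: Series_ext => i; rewrite /= binnerZl FreM.
rewrite -Series_plus; try exact: ex.
by apply: Series_ext => i; rewrite /= binnerZl FimM.
Qed.

Lemma l2innerC u v : l2inner v u = Fconj (l2inner u v).
Proof.
apply: scal_ext; rewrite ?(Fre_conj, Fim_conj) ?Fre_series ?Fim_series -?Series_opp;
by apply: Series_ext => i; rewrite /= binnerC ?Fre_conj ?Fim_conj.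
Qed.

Lemma l2norm2 u : Fre (l2inner u u) = Series (fun i => bnorm (sval u i)).
Proof. exact: Fre_series. Qed.

Lemma l2inner_ge0 u : (0 <= Fre (l2inner u u))%Re.
Proof.
rewrite l2norm2.
have := term_le_Series (fun i => bnorm_ge0 (sval u i)) (svalP u) 0.
exact/Rle_trans/bnorm_ge0.
Qed.

Lemma l2inner_eq0 u : Fre (l2inner u u) = R0 -> u = l2zero.
Proof.
rewrite l2norm2 => u0; apply: l2_ext => i; apply: bnorm_eq0.
exact: (Series_eq0 (fun i => bnorm_ge0 (sval u i)) (svalP u) u0 i).
Qed.

Lemma sum_n_lim (a : nat -> nat -> R) (b : nat -> R) :
  (forall i, is_lim_seq (fun m => a m i) (b i)) ->
  forall i, is_lim_seq (fun m => sum_n (a m) i) (sum_n b i).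
Proof.
move=> ab; elim=> [|i IH].
  by rewrite sum_O; apply: is_lim_seq_ext (ab 0%N) => m; rewrite sum_O.
rewrite sum_Sn; apply: is_lim_seq_ext (is_lim_seq_plus' _ _ _ _ IH (ab i.+1)) => m.
by rewrite sum_Sn.
Qed.

(** Coordinates converge by completeness of the scalars. The Cauchy bound holds on each finite
    partial sum, passes to the coordinatewise limit there, and then bounds the full series. *)
Lemma l2_complete (s : nat -> l2sum) :
  (forall eps, Rlt R0 eps -> exists N : nat, forall m n, (N <= m)%N -> (N <= n)%N ->
     Rlt (sqrt (Fre (l2inner (l2add (s m) (l2opp (s n))) (l2add (s m) (l2opp (s n)))))) eps) ->
  exists v, forall eps, Rlt R0 eps -> exists N : nat, forall n, (N <= n)%N ->
     Rlt (sqrt (Fre (l2inner (l2add (s n) (l2opp v)) (l2add (s n) (l2opp v))))) eps.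
Proof.
move=> sc.
pose D m n' i := sval (l2add (s m) (l2opp (s n'))) i.
have D0 m n' i : (0 <= bnorm (D m n' i))%Re by apply: bnorm_ge0.
have DS m n' : ex_series (fun i => bnorm (D m n' i)) by exact: (svalP (l2add (s m) (l2opp (s n')))).
have sc2 e : (0 < e)%Re -> exists N : nat, forall m n', (N <= m)%N -> (N <= n')%N ->
    (Series (fun i => bnorm (D m n' i)) < e * e)%Re.
  move=> e0; have [N NP] := sc e e0; exists N => m n' Nm Nn.
  have := NP m n' Nm Nn; have := l2inner_ge0 (l2add (s m) (l2opp (s n'))).
  by rewrite l2norm2; apply: sqrt_lt_sqr.
have lims i a : exists l, is_flim (fun m => sval (s m) i a 0) l.
  apply: flim_cauchy => e e0; have [N NP] := sc2 e e0.
  exists N => m n' Nm Nn; apply: Rle_lt_trans (NP m n' Nm Nn).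
  apply: Rle_trans (term_le_Series (D0 m n') (DS m n') i).
  have -> : sval (s m) i a 0 - sval (s n') i a 0 = D m n' i a 0.
    by rewrite /D /= scaleN1r !mxE.
  exact: bnorm_term.
pose l i a := sval (cid (lims i a)).
have lP i a : is_flim (fun m => sval (s m) i a 0) (l i a) by apply: (svalP (cid (lims i a))).
pose v : seqs := fun i => \col_a l i a.
(* Only a family of columns so far: [v] is not yet known to be square summable. *)
pose E n' i : 'cV[K]_(n i) := sval (s n') i + -1 *: v i.
have E0 n' i : (0 <= bnorm (E n' i))%Re by apply: bnorm_ge0.
have limD n' i : is_lim_seq (fun m => bnorm (D n' m i)) (bnorm (E n' i)).
  suff [] : is_flim (fun m => binner (D n' m i) (D n' m i)) (binner (E n' i) (E n' i)) by [].
  under eq_fun do rewrite binnerE; rewrite binnerE; apply: flim_sum => a.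
  apply: flim_mulconj; rewrite /E /D !mxE /=.
  under eq_fun do rewrite !mxE.
  apply: flimD; first exact: flim_cst.
  have [lr li] := lP i a; split; rewrite mulN1r !FrE; under eq_fun do rewrite mulN1r !FrE.
    by apply/(is_lim_seq_opp _ (Fre (l i a))).
  by apply/(is_lim_seq_opp _ (Fim (l i a))).
have Ebound e : (0 < e)%Re -> exists N : nat, forall n', (N <= n')%N ->
    ex_series (fun i => bnorm (E n' i)) /\ (Series (fun i => bnorm (E n' i)) <= e * e)%Re.
  move=> e0; have [N NP] := sc2 e e0; exists N => n' Nn.
  apply: bounded_series => // i.
  suff : Rbar_le (sum_n (fun i => bnorm (E n' i)) i) (e * e)%Re by [].
  (* The second index m tends to infinity with the partial sum fixed. *)
  apply: is_lim_seq_le_loc (sum_n_lim (i := i) (limD n')) (is_lim_seq_const (e * e)%Re).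
  exists N => m /leP Nm; apply: Rle_trans (Rlt_le _ _ (NP n' m Nn Nm)).
  exact: sum_n_le_Series.
have [N0 /(_ N0 (leqnn _)) [sE _]] := Ebound R1 Rlt_0_1.
have sv : square_summable v.
  (* [v] is the difference of the square summable families [s N0] and [E N0]. *)
  have := summableD (svalP (s N0)) (summableZ (-1) sE); congr square_summable.
  apply: functional_extensionality_dep => i.
  by rewrite /E !scaleN1r opprB addrC subrK.
(* Halving restores the strict inequality lost in the limit. *)
exists (exist _ v sv) => e e0; have e2 : (0 < e / 2)%Re by lra.
have [N NP] := Ebound _ e2; exists N => n' /NP [_ le].
rewrite l2norm2 -/(E n'); apply: Rle_lt_trans (_ : (e / 2 < e)%Re); last by lra.
rewrite -(sqrt_square (e / 2)); last by lra.
exact: sqrt_le_1_alt.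
Qed.

Definition l2hilbert : hilbert k.
Proof.
apply: (@Hilbert k l2sum l2zero l2add l2opp l2scale l2inner).
- by move=> u v w; apply: l2_ext => i /=; rewrite addrA.
- by move=> u v; apply: l2_ext => i /=; rewrite addrC.
- by move=> u; apply: l2_ext => i /=; rewrite addr0.
- by move=> u; apply: l2_ext => i /=; rewrite scaleN1r subrr.
- by move=> a b u; apply: l2_ext => i /=; rewrite scalerA.
- by move=> u; apply: l2_ext => i /=; rewrite scale1r.
- by move=> a u v; apply: l2_ext => i /=; rewrite scalerDr.
- by move=> a b u; apply: l2_ext => i /=; rewrite scalerDl.
- exact: l2innerDl.
- exact: l2innerZl.
- exact: l2innerC.
- exact: l2inner_ge0.
- exact: l2inner_eq0.
- exact: l2_complete.
Defined.

End DirectSum.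

(** * Block-diagonal operators *)

Section BlockDiagonal.
Variables (k : fkind) (g : nat) (n : nat -> nat).
Local Notation K := (scal k).

Lemma contraction_summable (Z : forall i, 'M[K]_(n i)) (u : l2sum k n) :
  (forall i v, (bnorm (Z i *m v) <= bnorm v)%Re) ->
  square_summable (fun i => Z i *m sval u i).
Proof. by move=> Zc; apply: summable_dom 1%Re _ (svalP u) => i; rewrite Rmult_1_l. Qed.

Definition blockop (Z : forall i, 'M[K]_(n i))
    (Zc : forall i v, (bnorm (Z i *m v) <= bnorm v)%Re) (u : l2hilbert k n) :
  l2hilbert k n := exist _ _ (contraction_summable u Zc).

Lemma blockop_bounded Z Zc : bounded_op (@blockop Z Zc).
Proof.
split; [|split].
- by move=> u v; apply: l2_ext => i /=; rewrite mulmxDr.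
- by move=> a u; apply: l2_ext => i /=; rewrite -scalemxAr.
exists 1%Re => u; rewrite Rmult_1_l; apply: sqrt_le_1_alt; rewrite !l2norm2.
by apply: Series_le (svalP u) => i; split; [apply: bnorm_ge0 | apply: Zc].
Qed.

Lemma blockop_adjoint Z Zc Zs Zsc : (forall i, Zs i = dagger (Z i)) ->
  is_adjoint (@blockop Z Zc) (@blockop Zs Zsc).
Proof.
move=> ZZs u v; apply: scal_ext; rewrite ?Fre_series ?Fim_series;
by apply: Series_ext => i /=; rewrite binner_adjoint ZZs.
Qed.

Lemma op_eval_block (X Xs : 'I_g -> forall i, 'M[K]_(n i)) Xc Xsc p (u : l2hilbert k n) i :
  sval (op_eval (fun j => @blockop (X j) (Xc j)) (fun j => @blockop (Xs j) (Xsc j)) p u) i =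
  mxeval (fun j => X j i) (fun j => Xs j i) p *m sval u i.
Proof.
rewrite /op_eval /eval_poly /mxeval /linext.
elim: p => [|t p IH]; first by rewrite big_nil mul0mx.
rewrite big_cons mulmxDl -IH /= -scalemxAl; congr (_ *: _ + _).
elim: t.2 u {IH} => [|[j e] w IH] u; first by rewrite /wordmx /= mul1mx.
by rewrite wordmx_cons -mulmxA -IH /letmx /=; case: e.
Qed.

(** Vectors supported in one block are the test vectors that recover each block of an operator. *)
Lemma summable_single i (c : 'cV[K]_(n i)) :
  square_summable (dfwith (fun i' => 0 : 'cV[K]_(n i')) c).
Proof.
set f := dfwith _ _; pose a m := bnorm (f m).
have ai : a i = bnorm c by rewrite /a /f dfwith_in.
have f0 m : i != m -> a m = R0 by move=> im; rewrite /a /f dfwith_out // bnorm0.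
have suma m : sum_n a m = if (i <= m)%N then bnorm c else R0.
  elim: m => [|m IH].
    rewrite sum_O; case: ltngtP => // [i0|/esym i0]; last by rewrite -ai -i0.
    by rewrite f0 // gtn_eqF.
  rewrite sum_Sn IH; case: (ltngtP i m.+1) => im.
  - by rewrite -ltnS im f0 ?ltn_eqF // plus_zero_r.
  - by rewrite leqNgt (ltnW im) /= f0 ?gtn_eqF // plus_zero_r.
  - have -> : (i <= m)%N = false by rewrite im ltnn.
    by rewrite -im ai plus_zero_l.
have [] // := @bounded_series a (bnorm c) => m; first exact: bnorm_ge0.
by rewrite suma; case: ifP => _; [apply: Rle_refl | apply: bnorm_ge0].
Qed.

End BlockDiagonal.

(** * Assembly of the Hilbert space model and the hard radical *)

Theorem theorem1p4 (k : fkind) (g : nat) (S : ncpoly k g -> Prop)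
  (S_hom : forall q, S q -> homogeneous q)
  (S_an : forall q, S q -> analytic q)
  (I_proper : exists p : ncpoly k g, ~ in_star_ideal S p) :
  (exists (H : hilbert k) (X Xs : 'I_g -> H -> H),
      (forall j, bounded_op (X j)) /\
      (forall j, is_adjoint (X j) (Xs j)) /\
      (forall p : ncpoly k g,
          (forall v : H, op_eval X Xs p v = hzero H) <-> in_star_ideal S p))
  /\ (forall p : ncpoly k g, hard_radical S p <-> in_star_ideal S p).
Proof.
have [n [X [X0 XI Xc]]] := countable_family S_hom S_an.
split; last first.
  move=> p; split=> [pr|mp m _ Y Y0]; last exact: Y0.
  (* Each block is itself a matrix point of the ideal, so p in the hard radical vanishes there. *)
  apply: XI => i; apply/matrixP => a b; rewrite [RHS]mxE.
  have toX : (fun j => \matrix_(i', l) tomat (X i j) i' l) = X i.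
    by apply/funext => j; apply: tomatK.
  have := pr (n i) _ (fun j => tomat (X i j)); rewrite /mat_is_zero.
  (* A block of size 0 has no entry to check; the index [a] witnesses a positive size. *)
  have ni : (0 < n i)%N by case: (n i) a => [[]|].
  move=> /(_ ni) h; have /(_ _ a b) := h.
  rewrite mat_evalE toX; apply; [|exact: ltn_ord|exact: ltn_ord].
  move=> q mq a' b' an bn.
  by rewrite (mat_evalE _ _ (Ordinal an) (Ordinal bn)) toX X0 // mxE.
pose Z j i := X i j; pose Zs j i := dagger (X i j).
have Zc j i v : (bnorm (Z j i *m v) <= bnorm v)%Re by case: (Xc i j v).
have Zsc j i v : (bnorm (Zs j i *m v) <= bnorm v)%Re by case: (Xc i j v).
exists (l2hilbert k n), (fun j => blockop (Zc j)), (fun j => blockop (Zsc j)).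
split; first by move=> j; apply: blockop_bounded.
split; first by move=> j; apply: blockop_adjoint.
move=> p; split=> [p0|mp v]; last first.
  by apply: l2_ext => i; rewrite op_eval_block [mxeval _ _ _]X0 // mul0mx.
apply: XI => i; apply/matrixP => a b; rewrite [RHS]mxE.
(* Coordinate a of the image of the b-th basis vector of block i is the (a, b) entry of p at that
   block. *)
have := congr1 (fun u : l2sum k n => sval u i a 0)
  (p0 (exist _ _ (summable_single (delta_mx b 0 : 'cV[scal k]_(n i))))).
by rewrite op_eval_block /= dfwith_in -colE !mxE.
Qed.
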